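(* For every $A\ge1$ there is a constant $C=C(A)>0$, depending only on $A$, such that the following holds. Let $\delta\in(0,1/3)$, $d\ge1$, $\beta\ge2$. Suppose that: (a) $(X,Y),(X_1,Y_1),\dots,(X_n,Y_n)$ are independent and identically distributed; (b) $X$ has a density $f_X$ on $[0,1]^d$ and there are constants $M,b>0$ with $b\le f_X(x)\le M$ for all $x\in[0,1]^d$; (c) conditionally on $X$, the noise $\varepsilon=Y-g(X)$ is sub-Gaussian with parameter $\sigma^2$: $\mathbb E[\varepsilon\mid X]=0$ and $\mathbb E[\exp(s\varepsilon)\mid X]\le\exp(s^2\sigma^2/2)$ for all $s\in\mathbb R$; (d) $g$ is $L$-Lipschitz on $[0,1]^d$ with respect to $\|\cdot\|_2$. Then there is $n_0=n_0(A,d,\delta)$ such that for all $n\ge n_0$ and every integer $m$ with $A^{-1}r\le m\le A\,r$, where $r=n^{2/(d+2)}\log((n+1)^{2d}/\delta)^{d/(d+2)}$, the local map $\mathcal V$ given by the final partition of the shape regular (SR) tree with input parameters $\beta$, $m$ and cost function $M_n$ (see context) satisfies, with probability at least $1-3\delta$, $$\sup_{x\in[0,1]^d}|\hat g_{\mathcal V}(x)-g(x)|\le C\,c\left(\frac1n\log\left(\frac{(n+1)^{2d}}{\delta}\right)\right)^{1/(d+2)},\qquad c=\sqrt{2\sigma^2}+\beta L\sqrt d\left(\frac5b\right)^{1/d}.$$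
   Context: $S_X=[0,1]^d$, $g(x)=\mathbb E[Y\mid X=x]$, $nP_n^X(V)=\sum_{i=1}^n\mathbf 1_V(X_i)$. For a hyper-rectangle $V$ with side lengths $h_k(V)$, $h_-(V)=\min_kh_k(V)$ and $h_+(V)=\max_kh_k(V)$. Splits: $S=\{1,\dots,d\}\times(0,1)$. A split $(p,u)\in S$ of a cell (hyper-rectangle) $V$ partitions $V$ by a cut orthogonal to coordinate $p$ into a left child $V(l)$ with $h_p(V(l))=u\,h_p(V)$ and a right child $V(r)$ with $h_p(V(r))=(1-u)h_p(V)$, other side lengths unchanged. Define $$S_\beta(V)=\{(p,u)\in S:h_+(V(s))\le\beta h_-(V(s))\ \forall s\in\{l,r\}\},$$ $$S_m(V)=\{(p,u)\in S:nP_n^X(V(s))\ge m\ \forall s\in\{l,r\}\}.$$ Cost function: $M_n:S\times\mathcal R([0,1]^d)\to\mathbb R$, where $\mathcal R([0,1]^d)$ is the set of hyper-rectangles in $[0,1]^d$; $M_n$ is arbitrary, may depend on the whole sample $(X_i,Y_i)_{i\le n}$, and is assumed to be such that for every cell $V$ with $S_m(V)\ne\emptyset$ considered by the construction, $(p,u)\mapsto M_n((p,u),V)$ has a minimizer on $S_\beta(V)\cap S_m(V)$. SR tree: start from the partition $\{[0,1]^d\}$. At each step, every cell $V$ of the current partition with $S_m(V)\ne\emptyset$ is replaced by its two children for a split minimizing $M_n(\cdot,V)$ over $S_\beta(V)\cap S_m(V)$; a cell with $S_m(V)=\emptyset$ is left unchanged. Stop when the partition no longer changes. $\mathcal V(x)$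 is the cell of the final partition containing $x$. The estimator is $\hat g_{\mathcal V}(x)=\sum_{i=1}^nY_i\mathbf 1_{\mathcal V(x)}(X_i)/\sum_{i=1}^n\mathbf 1_{\mathcal V(x)}(X_i)$. *)

(* Defs.v *)
From HB Require Import structures.
From mathcomp Require Import all_boot all_order all_algebra.
From mathcomp Require Import all_classical all_reals all_analysis.
Import Order.TTheory GRing.Theory Num.Theory.
Import numFieldNormedType.Exports.

Set Implicit Arguments.
Unset Strict Implicit.
Unset Printing Implicit Defensive.

Local Open Scope classical_set_scope.
Local Open Scope ring_scope.

(* Points of R^d are d.-tuple R, with the library's product sigma-algebra.
   Lebesgue measure on them is built one coordinate at a time, as the image of
   lebesgue_measure \x lebesgue_tuple d under (t, x) |-> t :: x. *)
Section lebesgue_tuple.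
Context {R : realType}.

Definition tuple_cons (d : nat) (p : measurableTypeR R * d.-tuple R) :
  d.+1.-tuple R := cons_tuple p.1 p.2.

Lemma measurable_tuple_cons (d : nat) :
  measurable_fun [set: measurableTypeR R * d.-tuple R] (@tuple_cons d).
Proof. exact: measurable_cons. Qed.

Section step.
Local Open Scope ereal_scope.
Context (d : nat) (mu : {sigma_finite_measure set (d.-tuple R) -> \bar R}).

Definition lebesgue_cons : set (d.+1.-tuple R) -> \bar R :=
  pushforward (lebesgue_measure \x mu) (@tuple_cons d).

Let measurable_preimage (A : set (d.+1.-tuple R)) :
  measurable A -> measurable (@tuple_cons d @^-1` A).
Proof. by move=> mA; rewrite -[X in measurable X]setTI; exact: measurable_tuple_cons. Qed.

Let lebesgue_cons0 : lebesgue_cons set0 = 0.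
Proof. by rewrite /lebesgue_cons /pushforward preimage_set0 measure0. Qed.

Let lebesgue_cons_ge0 A : 0 <= lebesgue_cons A.
Proof. by apply: integral_ge0 => x _; exact: measure_ge0. Qed.

Let lebesgue_cons_sigma_additive : semi_sigma_additive lebesgue_cons.
Proof.
move=> F mF tF mUF; rewrite /lebesgue_cons /pushforward preimage_bigcup.
apply: measure_semi_sigma_additive.
- by move=> n; exact: measurable_preimage.
- apply/trivIsetP => /= i j _ _ ij; rewrite -preimage_setI.
  by move/trivIsetP : tF => /(_ _ _ _ _ ij) ->//; rewrite preimage_set0.
- by rewrite -preimage_bigcup; exact: measurable_preimage.
Qed.

HB.instance Definition _ := isMeasure.Build _ _ _ lebesgue_cons
  lebesgue_cons0 lebesgue_cons_ge0 lebesgue_cons_sigma_additive.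

Let lebesgue_cons_sigma_finite : sigma_finite setT lebesgue_cons.
Proof.
have /sigma_finiteP[F [TF ndF Foo]] :=
  sigma_finiteT (@lebesgue_measure R).
have /sigma_finiteP[G [TG ndG Goo]] := sigma_finiteT mu.
pose un (t : d.+1.-tuple R) : measurableTypeR R * d.-tuple R :=
  (thead t, [tuple of behead t]).
have consK t : tuple_cons (un t) = t by apply/val_inj; case/tupleP: t.
have unK p : un (tuple_cons p) = p.
  by case: p => x t; rewrite /un /tuple_cons/=; congr pair; apply/val_inj.
have mun : measurable_fun setT un.
  apply/measurable_fun_pair => /=; first exact: measurable_tnth.
  exact: measurable_behead.
exists (fun k => un @^-1` (F k `*` G k)).
  apply/esym; rewrite -subTset => t _.
  have [i _ Fi] : (\bigcup_i F i) (un t).1 by rewrite -TF.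
  have [j _ Gj] : (\bigcup_i G i) (un t).2 by rewrite -TG.
  exists (maxn i j) => //; split.
  - by move: Fi; exact/subsetPset/ndF/leq_maxl.
  - by move: Gj; exact/subsetPset/ndG/leq_maxr.
move=> k; have [mF Fk] := Foo k; have [mG Gk] := Goo k; split.
  rewrite -[X in measurable X]setTI; apply: mun => //.
  exact: measurableX.
rewrite /lebesgue_cons /pushforward -comp_preimage.
rewrite (_ : un \o @tuple_cons d = id); last by apply/funext => p; exact: unK.
by rewrite preimage_id product_measure1E// lte_mul_pinfty// ge0_fin_numE.
Qed.

HB.instance Definition _ := Measure_isSigmaFinite.Build _ _ _ lebesgue_cons
  lebesgue_cons_sigma_finite.

End step.

Fixpoint lebesgue_tuple (d : nat) :
    {sigma_finite_measure set (d.-tuple R) -> \bar R} :=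
  match d with
  | 0 => \d_([tuple] : 0.-tuple R)
  | d'.+1 => lebesgue_cons (lebesgue_tuple d')
  end.

End lebesgue_tuple.

Section regression_model.
Context {R : realType}.

Definition unit_cube (d : nat) : set (d.-tuple R) :=
  [set x | forall k, 0 <= tnth x k <= 1].

Definition dist2 (d : nat) (x y : d.-tuple R) : R :=
  Num.sqrt (\sum_(k < d) (tnth x k - tnth y k) ^+ 2).

Definition lipschitz_on_cube (d : nat) (L : R) (g : d.-tuple R -> R) : Prop :=
  forall x y, unit_cube x -> unit_cube y ->
    `|g x - g y| <= L * dist2 x y.

Context {dO : measure_display} {Omega : measurableType dO}.
Variable P : probability Omega R.

Definition mutually_independent (dT : measure_display) (T : measurableType dT)
    (I : finType) (Z : I -> Omega -> T) : Prop :=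
  forall (J : {set I}) (B : I -> set T), (forall i, measurable (B i)) ->
    P (\bigcap_(i in [set` J]) Z i @^-1` B i) =
    (\prod_(i in J) P (Z i @^-1` B i))%E.

Definition identically_distributed (dT : measure_display)
    (T : measurableType dT) (I : finType) (Z : I -> Omega -> T) : Prop :=
  forall (i j : I) (B : set T), measurable B ->
    P (Z i @^-1` B) = P (Z j @^-1` B).

Definition has_density_on_cube (d : nat) (X : Omega -> d.-tuple R)
    (f : d.-tuple R -> R) : Prop :=
  [/\ measurable_fun (unit_cube (d := d)) f,
      forall x, unit_cube x -> 0 <= f x &
      forall B : set (d.-tuple R), measurable B ->
        P (X @^-1` B) =
        (\int[lebesgue_tuple d]_(x in B `&` unit_cube (d := d)) (f x)%:E)%E].

(* h is a version of x |-> E[Z | X = x]. *)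
Definition is_cond_expectation (dT : measure_display) (T : measurableType dT)
    (X : Omega -> T) (Z : Omega -> R) (h : T -> R) : Prop :=
  [/\ P.-integrable setT (EFin \o Z), measurable_fun setT h &
      forall B : set T, measurable B ->
        (\int[P]_(w in X @^-1` B) (Z w)%:E =
         \int[P]_(w in X @^-1` B) (h (X w))%:E)%E].

Definition cond_sub_gaussian (dT : measure_display) (T : measurableType dT)
    (X : Omega -> T) (eps : Omega -> R) (sigma : R) : Prop :=
  is_cond_expectation X eps (cst 0) /\
  forall s : R, exists2 h : T -> R,
    is_cond_expectation X (fun w => expR (s * eps w)) h &
    {ae P, forall w, h (X w) <= expR (s ^+ 2 * sigma ^+ 2 / 2)}.

End regression_model.

Section tree.
Context {R : realType}.

(* A cell is a product of intervals, one for each coordinate. *)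
Definition hrect (d : nat) := d.-tuple (interval R).

Definition in_hrect (d : nat) (V : hrect d) (x : d.-tuple R) : bool :=
  [forall k, tnth x k \in tnth V k].

Definition unit_hrect (d : nat) : hrect d := [tuple `[0, 1] | _ < d].

Section cell.
Context {d : nat}.
Implicit Types (V : hrect d) (k : 'I_d).

Definition lower V k : R := fine (tnth V k).1.
Definition upper V k : R := fine (tnth V k).2.
Definition side_length V k : R := upper V k - lower V k.

Definition h_plus V : R := \big[Num.max/0]_(k < d) side_length V k.
(* The seed h_plus V is neutral: it is at least every side length. *)
Definition h_minus V : R := \big[Num.min/h_plus V]_(k < d) side_length V k.

Definition set_side V (p : 'I_d) (I : interval R) : hrect d :=
  [tuple if k == p then I else tnth V k | k < d].

Definition cut_point V (s : 'I_d * R) : R :=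
  lower V s.1 + s.2 * side_length V s.1.

(* The two children partition V; the cutting hyperplane itself belongs to the
   right child if b is true, and to the left child if b is false. *)
Definition left_child (b : bool) V (s : 'I_d * R) : hrect d :=
  set_side V s.1 (Interval (tnth V s.1).1 (BSide b (cut_point V s))).
Definition right_child (b : bool) V (s : 'I_d * R) : hrect d :=
  set_side V s.1 (Interval (BSide b (cut_point V s)) (tnth V s.1).2).

End cell.

Section shape_regular_tree.
Context {d n : nat}.
Variables (beta : R) (m : nat) (b : bool).
(* The cost may depend on the whole sample, its first argument. *)
Variable cost : ('I_n -> d.-tuple R * R) -> 'I_d * R -> hrect d -> R.
Variable z : 'I_n -> d.-tuple R * R.
Implicit Types (V W : hrect d) (s t : 'I_d * R) (Q : set (hrect d)).

Definition sample_count V : nat := (\sum_(i < n) in_hrect V (z i).1)%N.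

Definition admissible_splits : set ('I_d * R) := [set s | 0 < s.2 < 1].

Definition S_beta V : set ('I_d * R) :=
  [set s | admissible_splits s /\
    forall W, W = left_child b V s \/ W = right_child b V s ->
      h_plus W <= beta * h_minus W].

Definition S_m V : set ('I_d * R) :=
  [set s | admissible_splits s /\
    forall W, W = left_child b V s \/ W = right_child b V s ->
      (m <= sample_count W)%N].

Definition cost_minimizer V s : Prop :=
  (S_beta V `&` S_m V) s /\
  forall t, (S_beta V `&` S_m V) t -> cost z s V <= cost z t V.

(* Ties between minimizers may be broken arbitrarily. *)
Definition sr_update V (Q : set (hrect d)) : Prop :=
  (S_m V = set0 /\ Q = [set V]) \/
  (S_m V !=set0 /\ exists2 s, cost_minimizer V s &
    Q = [set left_child b V s; right_child b V s]).

Definition sr_step (Q Q' : set (hrect d)) : Prop :=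
  exists2 f : hrect d -> set (hrect d),
    (forall V, Q V -> sr_update V (f V)) & Q' = \bigcup_(V in Q) f V.

(* Q k is the partition after k steps. *)
Definition sr_construction (Q : nat -> set (hrect d)) : Prop :=
  Q 0 = [set unit_hrect d] /\ forall k, sr_step (Q k) (Q k.+1).

Definition minimizers_exist (Q : nat -> set (hrect d)) : Prop :=
  forall k V, Q k V -> S_m V !=set0 -> exists s, cost_minimizer V s.

(* The cell of the partition Q that contains x. *)
Definition local_map (Q : set (hrect d)) (x : d.-tuple R) : hrect d :=
  xget (unit_hrect d) [set V | Q V /\ in_hrect V x].

Definition tree_estimator (Q : set (hrect d)) (x : d.-tuple R) : R :=
  (\sum_(i < n) (z i).2 * (in_hrect (local_map Q x) (z i).1)%:R) /
  (\sum_(i < n) (in_hrect (local_map Q x) (z i).1)%:R).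

End shape_regular_tree.

End tree.

Definition log_term {R : realType} (d n : nat) (delta : R) : R :=
  ln (n.+1%:R ^+ (2 * d) / delta).

(* Main.v *)
(** No uniform (Vapnik-Chervonenkis) deviation bound for cell frequencies is
    needed. Write lam = log((n+1)^(2d) / delta) and t = (lam / n)^(1/(d+2)), so
    that the leaf size m is of order n t^d = lam / t^2.

    Bias. Cut the cube into N^d <= n grid cubes, each of mass at least 4m/n; by
    Chernoff's bound and a union bound all of them contain m sample points. If
    all sides of a cell exceeded 4/N, both halves of the cell would contain a
    grid cube, so the cell could still be split. Hence every terminal cell has
    h_- <= 4/N, and h_+ <= beta h_- controls its diameter.

    Noise. The sample points of a cell are those of the box spanned by at most
    2d of them, which leaves n^(2d) candidate index sets. Such a set depends on
    the X_i, so the exponential moment is computed conditionally on their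
    values rounded to finitely many rational thresholds: the conditioning
    events are then rectangles, and independence turns expectations of products
    into products of expectations. For a fixed sample the rounded boxes
    eventually agree with the true ones. *)

Require Import Defs.
From HB Require Import structures.
From mathcomp Require Import all_boot all_order all_algebra.
From mathcomp Require Import all_classical all_reals all_analysis.
From mathcomp Require Import measurable_realfun ring lra.
Import Order.TTheory GRing.Theory Num.Theory.
Import numFieldNormedType.Exports.

Set Implicit Arguments.
Unset Strict Implicit.
Unset Printing Implicit Defensive.

Local Open Scope classical_set_scope.
Local Open Scope ring_scope.

(** * Expectations of products of independent variables *)

Section weighted_integral.
Import HBNNSimple.
Context {d dT} {Omega : measurableType d} {T : measurableType dT} {R : realType}.
Variables (mu : {measure set Omega -> \bar R}) (Z Z' : Omega -> T).
Variables u v : Omega -> R.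
Hypotheses (mZ : measurable_fun setT Z) (mZ' : measurable_fun setT Z').
Hypotheses (mu_u : measurable_fun setT u) (mu_v : measurable_fun setT v).
Hypotheses (u0 : forall w, 0 <= u w) (v0 : forall w, 0 <= v w).

Let integral_weighted_nnsfun (Y : Omega -> T) (w : Omega -> R)
    (f : {nnsfun T >-> R}) :
  measurable_fun setT Y ->
  measurable_fun setT w -> (forall x, 0 <= w x) ->
  (\int[mu]_x (w x * f (Y x))%:E =
   \sum_(y \in range f) y%:E *
     \int[mu]_x (w x * \1_(f @^-1` [set y]) (Y x))%:E)%E.
Proof.
move=> mY mw w0.
under eq_integral => x _.
  rewrite fimfunE mulr_fsumr// -fsumEFin//.
  under eq_fsbigr do rewrite mulrCA EFinM.
  over.
rewrite ge0_integral_fsum//.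
- apply: eq_fsbigr => y; rewrite inE /= => -[t _ <-].
  rewrite ge0_integralZl_EFin//.
  + by move=> x _; rewrite lee_fin mulr_ge0.
  + apply/measurable_EFinP/measurable_funM => //.
    exact: (measurableT_comp (measurable_indic _)).
- move=> y; apply: emeasurable_funM => //.
  apply/measurable_EFinP/measurable_funM => //.
  exact: (measurableT_comp (measurable_indic _)).
- move=> y x _; rewrite -EFinM lee_fin mulrCA mulr_ge0//.
  rewrite indicE; case: (boolP (Y x \in _)) => [|_]; last by rewrite mulr0.
  by rewrite inE /= => <-; rewrite mulr1.
Qed.

(** Linearity carries the hypothesis from indicators to nonnegative simple functions, and monotone
    convergence carries it to [f]. Allowing different weights and different maps on the two sides
    covers two uses: replacing one factor of a product by a constant, and transferring an
    expectation between variables with the same law. *)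
Lemma integral_weighted_comp (f : T -> R) :
  (forall B, measurable B ->
    (\int[mu]_w (u w * \1_B (Z w))%:E = \int[mu]_w (v w * \1_B (Z' w))%:E)%E) ->
  measurable_fun setT f -> (forall t, 0 <= f t) ->
  (\int[mu]_w (u w * f (Z w))%:E = \int[mu]_w (v w * f (Z' w))%:E)%E.
Proof.
move=> uv mf f0.
have mef : measurable_fun setT (EFin \o f) by exact/measurable_EFinP.
pose F := nnsfun_approx measurableT mef.
have mF (Y : Omega -> T) (w : Omega -> R) n :
    measurable_fun setT Y -> measurable_fun setT w ->
    measurable_fun setT (fun x => (w x * F n (Y x))%:E).
  move=> mY mw; apply/measurable_EFinP/measurable_funM => //.
  exact: measurableT_comp.
have F0 (Y : Omega -> T) (w : Omega -> R) n : (forall x, 0 <= w x) -> forall x, setT x ->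
   (0 <= (w x * F n (Y x))%:E)%E.
  by move=> w0 x _; rewrite lee_fin mulr_ge0.
have ndF (Y : Omega -> T) (w : Omega -> R) : (forall x, 0 <= w x) -> forall x, setT x ->
    {homo (fun n => (w x * F n (Y x))%:E) : m n / (m <= n)%N >-> (m <= n)%E}.
  move=> w0 x _ m n mn; rewrite lee_fin ler_wpM2l//.
  by have /lefP := @nd_nnsfun_approx _ _ _ _ measurableT _ mef _ _ mn.
have cvgF (Y : Omega -> T) (w : Omega -> R) x :
    (w x * F n (Y x))%:E @[n --> \oo] --> (w x * f (Y x))%:E.
  apply: cvg_EFin; first by near=> n.
  apply: cvgMr.
  have f0E t : setT t -> (0 <= (EFin \o f) t)%E by rewrite lee_fin.
  by have /fine_cvgP[_] := @cvg_nnsfun_approx _ _ _ _ measurableT _ mef f0E (Y x) I.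
have intF (Y : Omega -> T) (w : Omega -> R) :
    measurable_fun setT Y -> measurable_fun setT w -> (forall x, 0 <= w x) ->
    (\int[mu]_x (w x * f (Y x))%:E =
     limn (fun n => \int[mu]_x (w x * F n (Y x))%:E))%E.
  move=> mY mw w0; rewrite -monotone_convergence//.
  - by apply: eq_integral => x _; apply/esym/cvg_lim => //; exact: cvgF.
  - by move=> n; exact: mF.
  - by move=> n; exact: F0.
  - exact: ndF.
rewrite !intF//; congr (limn _); apply/funext => n.
by rewrite !integral_weighted_nnsfun//; apply: eq_fsbigr => y _; rewrite uv.
Unshelve. all: by end_near. Qed.

End weighted_integral.

Section product_expectation.
Context {d dT} {Omega : measurableType d} {T : measurableType dT} {R : realType}.
Variables (P : probability Omega R) (I : finType) (Z : I -> Omega -> T).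
Hypothesis mZ : forall i, measurable_fun setT (Z i).
Hypothesis indepZ : mutually_independent P Z.

Let integral_prod_indic (B : I -> set T) : (forall i, measurable (B i)) ->
  (\int[P]_w (\prod_i \1_(B i) (Z i w))%:E = \prod_i P (Z i @^-1` B i))%E.
Proof.
move=> mB; have mZB i : measurable (Z i @^-1` B i).
  by rewrite -[X in measurable X]setTI; exact: mZ.
have /esym := indepZ (finset.setTfor I) mB.
under eq_bigl do rewrite finset.in_setT.
move=> ->; set C := \bigcap_(_ in _) _; have mC : measurable C.
  by apply: fin_bigcap_measurable => //; exact: finite_finset.
rewrite -[C]setIT -integral_indic//.
apply: eq_integral => w _; congr EFin; rewrite indicE.
have [BZ|] := boolP (w \in _).
  rewrite big1// => i _; rewrite indicE mem_set//.
  by move: BZ; rewrite inE => /(_ i); apply; rewrite /= finset.in_setT.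
apply: contraNeq => /prodf_neq0 ZB; rewrite inE => i _ /=.
have := ZB i isT; rewrite indicE pnatr_eq0 eqb0 negbK inE; exact.
Qed.

Let integral_indic_comp i B : measurable B ->
  (\int[P]_w (\1_B (Z i w))%:E = P (Z i @^-1` B))%E.
Proof.
move=> mB; rewrite -[in RHS](setIT (Z i @^-1` B)) -integral_indic//.
by rewrite -[X in measurable X]setTI; exact: mZ.
Qed.

Lemma integral_prod_indep (f : I -> T -> R) (e : I -> R) :
  (forall i, measurable_fun setT (f i)) -> (forall i t, 0 <= f i t) ->
  (forall i, \int[P]_w (f i (Z i w))%:E = (e i)%:E)%E ->
  (\int[P]_w (\prod_i f i (Z i w))%:E = (\prod_i e i)%:E)%E.
Proof.
(* Induction on the list [s] of indices whose factor may fail to be an indicator. For the empty list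
   the claim is the definition of independence. *)
suff H (s : seq I) : forall (f : I -> T -> R) (e : I -> R),
    (forall i, measurable_fun setT (f i)) -> (forall i t, 0 <= f i t) ->
    (forall i, \int[P]_w (f i (Z i w))%:E = (e i)%:E)%E ->
    (forall i, i \notin s -> exists2 B, measurable B & f i = \1_B) ->
    (\int[P]_w (\prod_i f i (Z i w))%:E = (\prod_i e i)%:E)%E.
  by move=> mf f0 fe; apply: (H (enum I)) => // i; rewrite mem_enum.
elim: s => [|i s IH] {}f {}e mf f0 fe fB.
  have /choice[B /all_and2[mB fE]] i : exists B, measurable B /\ f i = \1_B.
    by have [//|B] := fB i; exists B.
  under eq_integral => w _ do under eq_bigr do rewrite fE.
  rewrite integral_prod_indic// -prodEFin; apply: eq_bigr => i _.
  by rewrite -fe fE integral_indic_comp.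
have e0 j : 0 <= e j.
  by rewrite -lee_fin -fe integral_ge0// => w _; rewrite lee_fin.
(* The other factors serve as weight, random on one side and averaged on the other. It then suffices
   to treat an indicator in place of [f i], which removes [i] from the list. *)
pose u w := \prod_(j | j != i) f j (Z j w); pose v (w : Omega) := \prod_(j | j != i) e j.
have mu : measurable_fun setT u.
  by rewrite /u; under eq_fun do rewrite big_mkcond; apply: measurable_prod => j _;
    case: (j != i) => //; exact: measurableT_comp.
transitivity (\int[P]_w (u w * f i (Z i w))%:E)%E.
  by apply: eq_integral => w _; rewrite (bigD1 i)//= mulrC.
rewrite (@integral_weighted_comp _ _ _ _ _ P (Z i) (Z i) u v)//.
- under eq_integral => w _ do rewrite EFinM.
  rewrite ge0_integralZl_EFin//.
  + by rewrite fe -EFinM [in RHS](bigD1 i)//= mulrC.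
  + by move=> w _; rewrite lee_fin.
  + by apply/measurable_EFinP; exact: measurableT_comp.
  + by apply: prodr_ge0.
- exact: measurable_cst.
- by move=> w; rewrite /u prodr_ge0.
- by move=> w; rewrite /v prodr_ge0.
move=> B mB; have mZB : measurable (Z i @^-1` B).
  by rewrite -[X in measurable X]setTI; exact: mZ.
pose f' j := if j == i then \1_B else f j.
pose e' j := if j == i then fine (P (Z i @^-1` B)) else e j.
have eB : (\int[P]_w (\1_B (Z i w))%:E = (fine (P (Z i @^-1` B)))%:E)%E.
  rewrite fineK; last exact: fin_num_measure.
  exact: integral_indic_comp.
transitivity (\int[P]_w (\prod_j f' j (Z j w))%:E)%E.
  apply: eq_integral => w _; rewrite (bigD1 i)//= /f' eqxx mulrC; congr (_ * _)%:E.
  by apply: eq_bigr => j /negPf ->.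
rewrite (IH _ e').
- rewrite (bigD1 i)//= {1}/e' eqxx.
  under [RHS]eq_integral => w _ do rewrite EFinM.
  rewrite ge0_integralZl_EFin//.
  + rewrite eB -EFinM mulrC; congr (_ * _)%:E.
    by apply: eq_bigr => j /negPf; rewrite /e' => ->.
  + by apply/measurable_EFinP; exact: (measurableT_comp (measurable_indic _)).
  + by apply: prodr_ge0.
- by move=> j; rewrite /f'; case: ifP.
- by move=> j t; rewrite /f'; case: ifP.
- by move=> j; rewrite /f' /e'; have [{j}->|_] := eqVneq j i; rewrite ?eB ?fe.
- move=> j js; rewrite /f'; have [_|ji] := eqVneq j i; first by exists B.
  by apply: fB; rewrite in_cons negb_or ji.
Qed.

End product_expectation.

(** * Large deviations over a random index set *)

Lemma measurable_select {d} {Omega : measurableType d} (F : finType)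
    (W : Omega -> F) (A : F -> set Omega) :
  (forall a, measurable (W @^-1` [set a])) -> (forall a, measurable (A a)) ->
  measurable [set w | A (W w) w].
Proof.
move=> mW mA.
rewrite (_ : [set _ | _] = \bigcup_(a in setT) (W @^-1` [set a] `&` A a)).
  apply: fin_bigcup_measurable => // a _; exact: measurableI.
by apply/seteqP; split => [w Aw|w [a _ [/= <-]]]//; exists (W w).
Qed.

Lemma probability_le_integral {d} {Omega : measurableType d} {R : realType}
    (P : probability Omega R) (A : set Omega) (f : Omega -> R) :
  measurable A -> measurable_fun setT f -> (forall w, 0 <= f w) ->
  (forall w, A w -> 1 <= f w) -> (P A <= \int[P]_w (f w)%:E)%E.
Proof.
move=> mA mf f0 f1; rewrite -[A in P A]setIT -integral_indic//.
apply: ge0_le_integral => //.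
- exact/measurable_EFinP.
- exact/measurable_EFinP.
- move=> w _; rewrite lee_fin indicE; case: (boolP (w \in A)) => //.
  by rewrite inE => /f1.
Qed.

Lemma measurable_lt_set {d} {T : measurableType d} {R : realType} (f g : T -> R) :
  measurable_fun setT f -> measurable_fun setT g ->
  measurable [set x | f x < g x].
Proof.
move=> mf mg; rewrite -[X in measurable X]setTI.
by have := measurable_fun_ltr mf mg measurableT (Y := [set true]); apply.
Qed.

(** The finite information on which the choice of the summation set may depend. *)
Definition labels {Omega T : Type} {I F : finType} (q : T -> F)
  (Z : I -> Omega -> T) (w : Omega) : {ffun I -> F} := [ffun i => q (Z i w)].

(** The level that a sum of [k] independent sub-Gaussian variables exceeds with probability at most
    exp(-lam), by Chernoff's bound. *)
Definition deviation_bound {R : realType} (sigma lam : R) (k : nat) : R :=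
  Num.sqrt (2 * sigma ^+ 2 * lam * k%:R).

Definition large_deviation {Omega T : Type} {R : realType} {I F : finType}
    (q : T -> F) (Z : I -> Omega -> T) (noise : T -> R) (sigma lam : R)
    (J : {ffun I -> F} -> {set I}) : set Omega :=
  [set w | deviation_bound sigma lam #|J (labels q Z w)| <
           \sum_(i in J (labels q Z w)) noise (Z i w)].

Section quantized_deviation.
Context {d dT} {Omega : measurableType d} {T : measurableType dT} {R : realType}.
Variables (P : probability Omega R) (I F : finType) (Z : I -> Omega -> T).
Hypothesis mZ : forall i, measurable_fun setT (Z i).
Hypothesis indepZ : mutually_independent P Z.
Variables (q : T -> F) (noise : T -> R) (sigma : R).
Hypothesis mq : forall a, measurable (q @^-1` [set a]).
Hypothesis mnoise : measurable_fun setT noise.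
Hypothesis sigma0 : sigma != 0.
Hypothesis subgaussian : forall i s a,
  (\int[P]_w (expR (s * noise (Z i w)) * \1_(q @^-1` [set a]) (Z i w))%:E <=
   (expR (s ^+ 2 * sigma ^+ 2 / 2))%:E * P (Z i @^-1` (q @^-1` [set a])))%E.

Let mpre i (B : set T) : measurable B -> measurable (Z i @^-1` B).
Proof. by move=> mB; rewrite -[X in measurable X]setTI; exact: mZ. Qed.

Let mlabels a : measurable (labels q Z @^-1` [set a]).
Proof.
rewrite (_ : _ @^-1` _ =
    \bigcap_(i in setT) (Z i @^-1` (q @^-1` [set a i]))); last first.
  apply/seteqP; split => [w /= <- i _|w qa] /=; first by rewrite ffunE.
  by apply/ffunP => i; rewrite ffunE; exact: qa.
by apply: fin_bigcap_measurable => // i _; exact: mpre.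
Qed.

Let weight i a : R := fine (P (Z i @^-1` (q @^-1` [set a]))).

Let weight_ge0 i a : 0 <= weight i a.
Proof. exact: fine_ge0. Qed.

Let sum_weight i : \sum_a weight i a = 1.
Proof.
apply: EFin_inj; rewrite -sumEFin.
transitivity (\sum_a \int[P]_w (\1_(q @^-1` [set a]) (Z i w))%:E)%E.
  apply: eq_bigr => a _; rewrite fineK; last exact/fin_num_measure/mpre.
  by rewrite -[A in P A]setIT -integral_indic//; exact: mpre.
rewrite -ge0_integral_sum//=; last first.
  by move=> a; apply/measurable_EFinP; exact: (measurableT_comp (measurable_indic _)).
transitivity (\int[P]_w cst 1%E w)%E; last first.
  rewrite integral_cst//. by rewrite [X in (_ * X)%E]probability_setT mul1e.
apply: eq_integral => w _; rewrite sumEFin (bigD1 (q (Z i w)))//= big1 ?addr0.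
  by rewrite indicE mem_set.
by move=> a aq; rewrite indicE memNset//= => qa; rewrite qa eqxx in aq.
Qed.

Variables (J : {ffun I -> F} -> {set I}) (lam : R).
Hypothesis lam0 : 0 <= lam.

Let threshold a := deviation_bound sigma lam #|J a|.

Let threshold_ge0 a : 0 <= threshold a. Proof. exact: sqrtr_ge0. Qed.

Lemma measurable_large_deviation : measurable (large_deviation q Z noise sigma lam J).
Proof.
apply: (measurable_select (W := labels q Z)
  (A := fun a => [set w | threshold a < \sum_(i in J a) noise (Z i w)])) => // a.
apply: measurable_lt_set; first exact: measurable_cst.
under eq_fun do rewrite big_mkcond.
apply: measurable_sum => i; case: (i \in J a) => //.
exact: measurableT_comp.
Qed.

(** Once the labels are fixed to [a], the summation set is the fixed set [J a], and the event that
    the labels equal [a] is a product of conditions on single observations. The exponential moment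
    restricted to it therefore factorizes and is at most the probability of [a] times the usual
    sub-Gaussian factor. Summing over [a] costs nothing, as these probabilities add up to 1. *)
Lemma prob_large_deviation :
  (P (large_deviation q Z noise sigma lam J) <= (expR (- lam))%:E)%E.
Proof.
(* The minimizer in s of the Chernoff exponent s^2 sigma^2 |J a| / 2 - s [threshold a]. *)
pose s a := threshold a / (sigma ^+ 2 * #|J a|%:R).
pose tilt a i z := if i \in J a then expR (s a * noise z) else 1.
pose f a i z := tilt a i z * \1_(q @^-1` [set a i]) z.
have tilt_ge0 a i z : 0 <= tilt a i z.
  by rewrite /tilt; case: ifP => // _; exact: expR_ge0.
have f_ge0 a i z : 0 <= f a i z by rewrite mulr_ge0.
have mf a i : measurable_fun setT (f a i).
  apply: measurable_funM => //; rewrite /tilt; case: (i \in J a) => //.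
  by apply: (measurableT_comp (@measurable_expR R)); exact: measurable_funM.
pose c a := expR (s a ^+ 2 * sigma ^+ 2 / 2).
have int_f a i : (\int[P]_w (f a i (Z i w))%:E <=
    ((if i \in J a then c a else 1) * weight i (a i))%:E)%E.
  rewrite EFinM /weight fineK; last exact/fin_num_measure/mpre.
  rewrite /f /tilt; case: (i \in J a); first exact: subgaussian.
  under eq_integral do rewrite mul1r.
  rewrite mul1e -[A in P A]setIT -integral_indic//; exact: mpre.
pose e a i := fine (\int[P]_w (f a i (Z i w))%:E).
have eE a i : (\int[P]_w (f a i (Z i w))%:E = (e a i)%:E)%E.
  rewrite fineK// ge0_fin_numE.
    exact: le_lt_trans (int_f a i) (ltry _).
  by apply: integral_ge0 => w _; rewrite lee_fin.
(* The first factor drops the labels with empty [J a]: there the deviation event reads 0 < 0, while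
   the exponential factor would be 1 and exceed exp(-lam) for positive lam. *)
pose k a := (0 < #|J a|)%:R * expR (- (s a * threshold a)).
have k0 a : 0 <= k a by rewrite mulr_ge0// expR_ge0.
pose h w := \sum_a k a * \prod_i f a i (Z i w).
have mprod a : measurable_fun setT (fun w => \prod_i f a i (Z i w)).
  by apply: measurable_prod => i _; exact: measurableT_comp.
have term_ge0 a w : 0 <= k a * \prod_i f a i (Z i w).
  by rewrite mulr_ge0 ?prodr_ge0.
apply: (@le_trans _ _ (\int[P]_w (h w)%:E)%E).
  apply: probability_le_integral.
  - exact: measurable_large_deviation.
  - by apply: measurable_sum => a; exact: measurable_funM.
  - by move=> w; rewrite sumr_ge0.
  - move=> w; rewrite /large_deviation /= => LDw.
    rewrite /h (bigD1 (labels q Z w))//= ler_wpDr ?sumr_ge0//.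
    have -> : \prod_i f (labels q Z w) i (Z i w) =
        expR (s (labels q Z w) * \sum_(i in J (labels q Z w)) noise (Z i w)).
      rewrite mulr_sumr expR_sum [RHS]big_mkcond/=; apply: eq_bigr => i _.
      by rewrite /f /tilt indicE mem_set ?mulr1//= ffunE.
    have -> : k (labels q Z w) = expR (- (s (labels q Z w) * threshold (labels q Z w))).
      rewrite /k; case: posnP => [J0|]; last by rewrite mul1r.
      move: LDw; rewrite ltNge => /negP; case.
      by rewrite (cards0_eq J0) big_set0; exact: sqrtr_ge0.
    rewrite -expRD -expR0 ler_expR addrC -mulrBr mulr_ge0//.
      by rewrite divr_ge0 ?threshold_ge0// mulr_ge0 ?sqr_ge0.
    by rewrite subr_ge0 ltW.
rewrite /h; under eq_integral do rewrite -sumEFin.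
rewrite ge0_integral_sum//; last 2 first.
  - by move=> a; apply/measurable_EFinP; exact: measurable_funM.
  - by move=> a w _; rewrite lee_fin.
have int_term a : (\int[P]_w
    (k a * \prod_i f a i (Z i w))%:E <=
    (expR (- lam) * \prod_i weight i (a i))%:E)%E.
  under eq_integral do rewrite EFinM.
  rewrite ge0_integralZl_EFin//; last 2 first.
  - by move=> w _; rewrite lee_fin prodr_ge0.
  - exact/measurable_EFinP.
  rewrite (integral_prod_indep mZ indepZ (e := e a))// -EFinM lee_fin.
  apply: (@le_trans _ _ (k a *
      \prod_i ((if i \in J a then c a else 1) * weight i (a i)))).
    rewrite ler_wpM2l//; apply: ler_prod => i _.
    rewrite -!lee_fin -eE int_f andbT.
    by apply: integral_ge0 => w _; rewrite lee_fin.
  rewrite big_split/= mulrA ler_wpM2r ?prodr_ge0// -big_mkcond/= prodr_const.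
  rewrite /k; case: posnP => [_|J0]; first by rewrite !mul0r expR_ge0.
  rewrite mul1r -expRM_natl -expRD ler_expR.
  have N0 : (0 : R) < #|J a|%:R by rewrite ltr0n.
  have tE : threshold a ^+ 2 = 2 * sigma ^+ 2 * lam * #|J a|%:R.
    rewrite /threshold /deviation_bound sqr_sqrtr//.
    by rewrite mulr_ge0// mulr_ge0// mulr_ge0// sqr_ge0.
  have -> : - (s a * threshold a) + #|J a|%:R * (s a ^+ 2 * sigma ^+ 2 / 2) =
      threshold a ^+ 2 * (- (2 * sigma ^+ 2 * #|J a|%:R)^-1).
    by rewrite /s; field; rewrite sigma0 gt_eqF.
  suff -> : threshold a ^+ 2 * (- (2 * sigma ^+ 2 * #|J a|%:R)^-1) = - lam by [].
  by rewrite tE; field; rewrite sigma0 gt_eqF.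
apply: (@le_trans _ _ (\sum_(a : {ffun I -> F}) (expR (- lam) * \prod_i weight i (a i))%:E)%E).
  by apply: lee_sum => a _; exact: int_term.
(* The sum over all label functions of the product of weights is the product over [i] of the sums of
   weights, each equal to 1. *)
rewrite sumEFin lee_fin -mulr_sumr -(bigA_distr_bigA weight)/=.
under eq_bigr do rewrite sum_weight.
by rewrite big1// mulr1.
Qed.

End quantized_deviation.

Lemma measure_bigcup_finType_le {d} {T : measurableType d} {R : realType}
    (mu : {measure set T -> \bar R}) (J : finType) (A : J -> set T) (c : R) :
  (forall j, measurable (A j)) -> (forall j, (mu (A j) <= c%:E)%E) ->
  (mu (\bigcup_(j in setT) A j) <= (#|J|%:R * c)%:E)%E.
Proof.
move=> mA Ac; rewrite cardE.
suff [mB Bc] : measurable (\big[setU/set0]_(j <- enum J) A j) /\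
    (mu (\big[setU/set0]_(j <- enum J) A j) <= ((size (enum J))%:R * c)%:E)%E.
  apply: le_trans Bc; apply: le_measure; rewrite ?inE//.
    by apply: fin_bigcup_measurable.
  move=> x [j _ Ajx]; rewrite -bigcup_seq; exists j => //=; exact: mem_enum.
elim: (enum J) => [|j s [mB Bc]].
  by rewrite big_nil measure0 mul0r.
rewrite big_cons; split; first exact: measurableU.
apply: le_trans (measureU2 _ _ _) _ => //.
by rewrite /= -natr1 mulrDl mul1r addrC EFinD leeD.
Qed.

(** The tail intersections increase to the limit inferior, and each is contained in one of the
    [A n]. This transfers a bound for every rounding level to the unrounded sample. *)
Lemma measure_liminf_le {d} {T : measurableType d} {R : realType}
    (mu : {measure set T -> \bar R}) (A : (set T)^nat) (c : \bar R) :
  (forall n, measurable (A n)) -> (forall n, (mu (A n) <= c)%E) ->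
  (mu (\bigcup_n \bigcap_(k in [set k | (n <= k)%N]) A k) <= c)%E.
Proof.
move=> mA Ac; pose B n := \bigcap_(k in [set k | (n <= k)%N]) A k.
have mB n : measurable (B n) by apply: bigcap_measurableType.
have BA n : (mu (B n) <= c)%E.
  apply: le_trans (Ac n); apply: le_measure; rewrite ?inE//.
  by move=> x; apply => /=.
have ndB : {homo B : n m / (n <= m)%N >-> (n <= m)%O}.
  move=> n m nm; apply/subsetPset => x Bx k /= mk.
  by apply: Bx => /=; exact: leq_trans mk.
have cvgB := nondecreasing_cvg_mu (mu := mu) mB (bigcupT_measurable B mB) ndB.
rewrite -(cvg_lim _ cvgB)//; apply: lime_le.
  by apply/cvg_ex; eexists; exact: cvgB.
by near=> n; exact: BA.
Unshelve. all: by end_near. Qed.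

(** * Rounding coordinates to rational thresholds *)

Section quantize.
Context {R : realType}.

(** An enumeration of the rationals; a code of no rational yields 0. *)
Definition threshold_rat (j : nat) : R := ratr (odflt 0 (unpickle j)).

(** Encoding the rounded value as a set of thresholds turns the order of reals into inclusion. *)
Definition quantize (N : nat) (x : R) : {set 'I_N} :=
  [set j : 'I_N | threshold_rat j <= x]%SET.

Lemma measurable_quantize N a : measurable (quantize N @^-1` [set a]).
Proof.
rewrite (_ : _ @^-1` _ = \bigcap_(j in setT)
    (if j \in a then `[threshold_rat j, +oo[%classic
     else `]-oo, threshold_rat j[%classic)); last first.
  apply/seteqP; split=> [x /= <- j _|x xa].
    by rewrite finset.inE; case: leP => /= h; rewrite in_itv/= ?h ?andbT.
  apply/finset.setP => j; rewrite finset.inE.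
  have := xa j I; case: (j \in a); rewrite /= in_itv/= ?andbT//.
  by rewrite ltNge => /negPf.
by apply: fin_bigcap_measurable => // j _; case: ifP.
Qed.

(** If y < x, a rational strictly between them is eventually among the thresholds, and it lies below
    x but not below y. *)
Lemma near_subset_quantize (x y : R) :
  \forall N \near \oo, (quantize N x \subset quantize N y)%SET = (x <= y).
Proof.
have [xy|yx] := leP x y.
  near=> N; apply/fintype.subsetP => j; rewrite !finset.inE => /le_trans; exact.
have [r] := rat_in_itvoo yx; rewrite in_itv/= => /andP[yr rx].
near=> N; apply/negP => /fintype.subsetP sub.
have rN : (pickle r < N)%N by near: N; exact: nbhs_infty_gt.
have := sub (Ordinal rN); rewrite !finset.inE /threshold_rat/= pickleK/= (ltW rx).
by move=> /(_ isT); rewrite leNgt yr.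
Unshelve. all: by end_near. Qed.

End quantize.

(** * Noise summed over the boxes spanned by sample points *)

Definition between {R : realType} {d n : nat} (x : 'I_n -> d.-tuple R)
    (c : {ffun 'I_d * bool -> 'I_n}) : {set 'I_n} :=
  [set i | [forall k, tnth (x (c (k, false))) k <= tnth (x i) k <=
                      tnth (x (c (k, true))) k]]%SET.

Section noise.
Context {dO : measure_display} {Omega : measurableType dO} {R : realType}.
Context {d n : nat}.
Let T := (d.-tuple R * R)%type.
Variables (P : probability Omega R) (Z : 'I_n -> Omega -> T).
Hypothesis mZ : forall i, measurable_fun setT (Z i).
Hypothesis indepZ : mutually_independent P Z.
Variables (noise : T -> R) (sigma : R).
Hypothesis mnoise : measurable_fun setT noise.
Hypothesis subgaussian : forall i s (B : set (d.-tuple R)), measurable B ->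
  (\int[P]_w (expR (s * noise (Z i w)) * \1_B (Z i w).1)%:E <=
   (expR (s ^+ 2 * sigma ^+ 2 / 2))%:E * P (Z i @^-1` (fst @^-1` B)))%E.
Variable lam : R.
Hypothesis lam0 : 0 <= lam.

Let mpre i (B : set T) : measurable B -> measurable (Z i @^-1` B).
Proof. by move=> mB; rewrite -[X in measurable X]setTI; exact: mZ. Qed.

(** The union bound runs over the n^(2d) choices of [c] and the two signs of the sum. *)
Let conclusion (E : set Omega) :=
  [/\ measurable E, (P (~` E) <= (2 * n%:R ^+ (2 * d) * expR (- lam))%:E)%E &
   forall w, E w -> forall c,
     `|\sum_(i in between (fun i => (Z i w).1) c) noise (Z i w)| <=
     deviation_bound sigma lam #|between (fun i => (Z i w).1) c|].

Let label N (z : T) : {ffun 'I_d -> {set 'I_N}} :=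
  [ffun k => quantize N (tnth z.1 k)].

(** Labels reveal nothing about the responses, so the sub-Gaussian bound given the covariates
    applies on every label event. *)
Let mlabel N a : exists2 B, measurable B & label N @^-1` [set a] = fst @^-1` B.
Proof.
exists (\bigcap_(k in setT) (fun x : d.-tuple R => tnth x k) @^-1`
    (quantize N @^-1` [set a k])).
  apply: fin_bigcap_measurable => // k _; rewrite -[X in measurable X]setTI.
  apply: measurable_tnth => //; exact: measurable_quantize.
apply/seteqP; split => [z /= <- k _/=|z za/=]; first by rewrite ffunE.
by apply/ffunP => k; rewrite ffunE; exact: za.
Qed.

Let quantized_between N (c : {ffun 'I_d * bool -> 'I_n})
    (a : {ffun 'I_n -> {ffun 'I_d -> {set 'I_N}}}) : {set 'I_n} :=
  [set i | [forall k, (a (c (k, false)) k \subset a i k) &&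
                      (a i k \subset a (c (k, true)) k)]]%SET.

(** For a fixed sample the box memberships depend on finitely many comparisons of coordinates, all
    of which are decided correctly by the rounding once N is large. *)
Let near_quantized_between w : \forall N \near \oo, forall c,
  quantized_between c (labels (label N) Z w) = between (fun i => (Z i w).1) c.
Proof.
have H : \forall N \near \oo, forall p : 'I_n * 'I_n * 'I_d,
    (quantize N (tnth (Z p.1.1 w).1 p.2) \subset
     quantize N (tnth (Z p.1.2 w).1 p.2))%SET =
    (tnth (Z p.1.1 w).1 p.2 <= tnth (Z p.1.2 w).1 p.2).
  by apply: filter_forall => p; exact: near_subset_quantize.
near=> N => c; apply/finset.setP => i; rewrite !finset.inE.
apply: eq_forallb => k; rewrite !ffunE.
have HN : forall p : 'I_n * 'I_n * 'I_d,
    (quantize N (tnth (Z p.1.1 w).1 p.2) \subset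
     quantize N (tnth (Z p.1.2 w).1 p.2))%SET =
    (tnth (Z p.1.1 w).1 p.2 <= tnth (Z p.1.2 w).1 p.2) by near: N.
by rewrite (HN (_, _, k)) (HN (_, _, k)).
Unshelve. all: by end_near. Qed.

Let signed (b : bool) (z : T) : R := (-1) ^+ b * noise z.

Let deviation N (cb : {ffun 'I_d * bool -> 'I_n} * bool) :=
  large_deviation (label N) Z (signed cb.2) sigma lam (quantized_between cb.1).

Let msigned b : measurable_fun setT (signed b).
Proof. exact: measurable_funM. Qed.

Let noise_event_neq0 : sigma != 0 -> exists E, conclusion E.
Proof.
move=> sigma0; pose bad N := \bigcup_(cb in setT) deviation N cb.
have mlab N a : measurable (label N @^-1` [set a]).
  have [B mB ->] := mlabel a; rewrite -[X in measurable X]setTI.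
  by apply: measurable_fst.
have mdev N cb : measurable (deviation N cb).
  exact: (measurable_large_deviation mZ sigma (@mlab N) (msigned cb.2)).
have mbad N : measurable (bad N) by apply: fin_bigcup_measurable.
have Pbad N : (P (bad N) <= (2 * n%:R ^+ (2 * d) * expR (- lam))%:E)%E.
  rewrite (_ : 2 * _ = #|{: {ffun 'I_d * bool -> 'I_n} * bool}|%:R); last first.
    by rewrite card_prod card_ffun card_prod !card_ord card_bool natrM mulrC
      natrX mulnC.
  apply: measure_bigcup_finType_le => // cb.
  apply: (prob_large_deviation mZ indepZ (@mlab N) (msigned cb.2) sigma0) => //.
  move=> i s a; have [B mB ->] := mlabel a.
  rewrite /signed (_ : (s ^+ 2) = (s * (-1) ^+ cb.2) ^+ 2); last first.
    by rewrite exprMn sqrr_sign mulr1.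
  under eq_integral do rewrite mulrA.
  exact: subgaussian.
(* The samples for which infinitely many levels are not bad; one of these levels is also fine enough
   for the rounded boxes to be exact. *)
exists (~` (\bigcup_N \bigcap_(k in [set k | (N <= k)%N]) bad k)); split.
- apply: measurableC; apply: bigcup_measurable => N _.
  exact: bigcap_measurableType.
- by rewrite setCK; exact: measure_liminf_le.
- move=> w goodw c; have [N _ HN] := near_quantized_between w.
  have [k /= Nk nbad] : exists2 k, (N <= k)%N & ~ bad k w.
    apply: contrapT => no; apply: goodw; exists N => // k /= Nk.
    by apply: contrapT => nb; apply: no; exists k.
  rewrite -(HN k Nk c) ler_norml; apply/andP; split.
  + rewrite lerNl leNgt; apply/negP => dev; apply: nbad; exists (c, true) => //=.
    rewrite /deviation /large_deviation/= (le_lt_trans _ (lt_le_trans dev _))// -sumrN.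
    by rewrite le_eqVlt; apply/orP; left; apply/eqP; apply: eq_bigr => i _; rewrite /signed mulN1r.
  + rewrite leNgt; apply/negP => dev; apply: nbad; exists (c, false) => //=.
    by rewrite /deviation /large_deviation/=; under eq_bigr do rewrite /signed expr0 mul1r.
Qed.

(** Here the Chernoff parameter would divide by zero. Instead, exponential moments at most 1 for
    both signs of s force the noise to vanish almost surely. *)
Let noise_event0 : sigma = 0 -> exists E, conclusion E.
Proof.
move=> sigma_eq0.
have mexp s i : measurable_fun setT (fun w => expR (s * noise (Z i w))).
  apply: (measurableT_comp (@measurable_expR R)); apply: measurable_funM => //.
  exact: measurableT_comp.
have int1 i s : (\int[P]_w (expR (s * noise (Z i w)))%:E <= 1)%E.
  have := subgaussian i s measurableT.
  rewrite sigma_eq0 expr0n/= mulr0 mul0r expR0 mul1e preimage_setT.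
  rewrite [X in (_ <= X)%E]probability_setT.
  by under eq_integral do rewrite indicT mulr1.
(* [D] equals exp(e) + exp(-e) - 2 for the noise e, so its expectation is at most 0. Being a square
   it vanishes almost surely, and it is 0 only at e = 0. *)
pose D i w := (expR (2^-1 * noise (Z i w)) - expR (- 2^-1 * noise (Z i w))) ^+ 2.
have mD i : measurable_fun setT (D i).
  apply: measurable_funX; apply: measurable_funB; exact: mexp.
have intD i : (\int[P]_w (D i w)%:E = 0)%E.
  apply/eqP; rewrite eq_le integral_ge0 ?andbT => [|w _]; last first.
    by rewrite lee_fin sqr_ge0.
  have : (\int[P]_w (2 + D i w)%:E <= 2%:E)%E.
    rewrite (_ : 2%:E = 1 + 1)%E; last by rewrite -EFinD.
    apply: le_trans (leeD (int1 i 1) (int1 i (-1))).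
    rewrite -ge0_integralD//=; last 2 first.
    - exact/measurable_EFinP.
    - exact/measurable_EFinP.
    rewrite le_eqVlt; apply/orP; left; apply/eqP/eq_integral => w _.
    rewrite -EFinD /D; congr EFin; set e := noise _.
    have -> : expR (1 * e) = expR (2^-1 * e) ^+ 2.
      by rewrite expr2 -expRD; congr expR; lra.
    have -> : expR (-1 * e) = expR (- 2^-1 * e) ^+ 2.
      by rewrite expr2 -expRD; congr expR; lra.
    have ab : expR (2^-1 * e) * expR (- 2^-1 * e) = 1.
      by rewrite -expRD mulNr subrr expR0.
    by rewrite sqrrB ab; ring.
  under eq_integral do rewrite EFinD.
  rewrite ge0_integralD//=; last 2 first.
  - by move=> w _; rewrite lee_fin sqr_ge0.
  - exact/measurable_EFinP.
  rewrite integral_cst// [X in (_ * X)%E]probability_setT mule1.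
  by rewrite -[X in (_ <= X)%E -> _]adde0 leeD2lE.
pose N i := [set w | noise (Z i w) != 0].
have mN i : measurable (N i).
  rewrite (_ : N i = (noise \o Z i) @^-1` (~` [set 0])); last first.
    by apply/seteqP; split => w /= /eqP.
  rewrite -[X in measurable X]setTI; apply: (measurableT_comp mnoise (mZ i)) => //.
  by apply: measurableC; exact: measurable_set1.
have PN i : P (N i) = 0.
  have /ae_eq_integral_abs : measurable_fun setT (EFin \o D i).
    exact/measurable_EFinP.
  move=> /(_ P measurableT)[+ _].
  under eq_integral do rewrite /= ger0_norm ?sqr_ge0//.
  move=> /(_ (intD i)); move=> [A [mA PA subA]].
  apply/eqP; rewrite eq_le measure_ge0 andbT -PA.
  apply: le_measure; rewrite ?inE//.
  apply: subset_trans subA => w /=; rewrite /N/= => /eqP nw /(_ I)[].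
  move=> /eqP; rewrite /D sqrf_eq0 subr_eq0 => /eqP/expR_inj h; apply: nw.
  by move: h; lra.
exists (~` \bigcup_(i in setT) N i); split.
- by apply: measurableC; apply: fin_bigcup_measurable.
- rewrite setCK (@le_trans _ _ (#|'I_n|%:R * 0)%:E)//.
    by apply: measure_bigcup_finType_le => // j; have /eqP := PN j; rewrite eq_le => /andP[].
  by rewrite mulr0 lee_fin !mulr_ge0 ?expR_ge0 ?exprn_ge0.
- move=> w goodw c; rewrite big1 ?normr0 ?sqrtr_ge0// => i _.
  by apply: contrapT => nw; apply: goodw; exists i => //; exact/eqP.
Qed.

Lemma noise_event : exists E, conclusion E.
Proof.
by have [|] := eqVneq sigma 0; [exact: noise_event0|exact: noise_event_neq0].
Qed.

End noise.

(** * Hits of the grid cubes *)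

Section few_hits.
Context {d dT} {Omega : measurableType d} {T : measurableType dT} {R : realType}.
Variables (P : probability Omega R) (n : nat) (Z : 'I_n -> Omega -> T).
Hypothesis mZ : forall i, measurable_fun setT (Z i).
Hypothesis indepZ : mutually_independent P Z.
Variables (B : set T) (p : R) (m : nat).
Hypothesis mB : measurable B.
Hypothesis pB : forall i, (p%:E <= P (Z i @^-1` B))%E.
Hypothesis pm : 4 * m%:R <= n%:R * p.

Let few_hits := [set w | \sum_(i < n) \1_B (Z i w) < m%:R :> R].

Lemma measurable_few_hits : measurable few_hits.
Proof.
apply: measurable_lt_set; last exact: measurable_cst.
apply: measurable_sum => i.
exact: (measurableT_comp (measurable_indic mB) (mZ i)).
Qed.

(* Chernoff's bound with the exponential moment of parameter -1. *)
Lemma prob_few_hits : (P few_hits <= (expR (- m%:R))%:E)%E.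
Proof.
have mZB i : measurable (Z i @^-1` B).
  by rewrite -[X in measurable X]setTI; exact: mZ.
pose f (i : 'I_n) (z : T) : R := expR (- \1_B z).
have mf i : measurable_fun setT (f i).
  apply: (measurableT_comp (@measurable_expR R)).
  by apply: measurableT_comp => //; exact: measurable_indic.
pose q i := fine (P (Z i @^-1` B)).
have qE i : P (Z i @^-1` B) = (q i)%:E by rewrite fineK// fin_num_measure.
pose e i := 1 - q i + expR (-1) * q i.
have eE i : (\int[P]_w (f i (Z i w))%:E = (e i)%:E)%E.
  transitivity (\int[P]_w ((\1_(~` (Z i @^-1` B)) w)%:E +
      (expR (-1))%:E * (\1_(Z i @^-1` B) w)%:E))%E.
    apply: eq_integral => w _; rewrite /f !indicE in_setC.
    rewrite (_ : (w \in Z i @^-1` B) = (Z i w \in B))//.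
    by case: (Z i w \in B); rewrite /= -EFinM -EFinD ?mulr1 ?mulr0 ?add0r ?addr0 ?oppr0 ?expR0.
  rewrite ge0_integralD//=; last 2 first.
  - by apply/measurable_EFinP/measurable_indic/measurableC.
  - by apply: emeasurable_funM => //; apply/measurable_EFinP/measurable_indic.
  rewrite ge0_integralZl_EFin ?expR_ge0//; last first.
    by apply/measurable_EFinP/measurable_indic.
  rewrite !integral_indic//; last exact: measurableC.
  rewrite !setIT /e EFinD EFinM EFinB -qE.
  by congr (_ + _)%E; exact: probability_setC.
pose h w := expR m%:R * \prod_i f i (Z i w).
have mprod : measurable_fun setT (fun w => \prod_i f i (Z i w)).
  by apply: measurable_prod => i _; exact: measurableT_comp.
apply: (@le_trans _ _ (\int[P]_w (h w)%:E)%E).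
  apply: probability_le_integral.
  - exact: measurable_few_hits.
  - exact: measurable_funM.
  - by move=> w; rewrite mulr_ge0 ?expR_ge0// prodr_ge0// => i _; exact: expR_ge0.
  - move=> w; rewrite /few_hits/= => hw.
    rewrite /h /f -expR_sum -expRD -[leLHS]expR0 ler_expR sumrN subr_ge0.
    exact: ltW hw.
rewrite /h; under eq_integral do rewrite EFinM.
rewrite ge0_integralZl_EFin ?expR_ge0//; last 2 first.
- by move=> w _; rewrite lee_fin prodr_ge0// => i _; exact: expR_ge0.
- exact/measurable_EFinP.
rewrite (integral_prod_indep mZ indepZ (e := e))//; last first.
  by move=> i z; exact: expR_ge0.
rewrite -EFinM lee_fin.
(* Since exp(-1) <= 1/2, [e i] is at most 1 - q/2 <= exp(-q/2) with q >= p. *)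
have e_le i : 0 <= e i <= expR (- (p / 2)).
  have q0 : 0 <= q i by exact: fine_ge0.
  have pq : p <= q i by rewrite -lee_fin -qE.
  have q1 : q i <= 1 by rewrite -lee_fin -qE probability_le1.
  have e1 : expR (-1) <= 2^-1 :> R.
    rewrite expRN lef_pV2 ?posrE ?expR_gt0//.
    by have := @expR_ge1Dx R 1; apply: le_trans; lra.
  have e0 := @expR_ge0 R (-1).
  rewrite /e; apply/andP; split; first nra.
  apply: le_trans (expR_ge1Dx _); nra.
apply: (@le_trans _ _ (expR m%:R * \prod_(i < n) expR (- (p / 2)))).
  by rewrite ler_wpM2l ?expR_ge0// ler_prod.
rewrite prodr_const card_ord -expRM_natl -expRD ler_expR.
(* The exponent is m - n p / 2 <= m - 2 m; this is the source of the factor 4 in [pm]. *)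
by move: pm; lra.
Qed.

End few_hits.

Section box.
Context {R : realType}.

Definition box d (J : 'I_d -> interval R) : set (d.-tuple R) :=
  [set x | forall k, tnth x k \in J k].

Lemma measurable_box d (J : 'I_d -> interval R) : measurable (box J).
Proof.
rewrite (_ : box J = \bigcap_(k in setT) (fun x : d.-tuple R => tnth x k) @^-1` [set` J k]).
  apply: fin_bigcap_measurable => // k _; rewrite -[X in measurable X]setTI.
  by apply: measurable_tnth => //; exact: measurable_itv.
by apply/seteqP; split => [x xI k _|x xI k]; [exact: xI|exact: (xI k I)].
Qed.

Lemma lebesgue_tuple_box d (J : 'I_d -> interval R) :
  lebesgue_tuple d (box J) = (\prod_k lebesgue_measure [set` J k])%E.
Proof.
elim: d J => [|d IH] J.
  by rewrite big_ord0/= diracE mem_set// => -[].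
rewrite big_ord_recl -IH /= /lebesgue_cons /pushforward.
rewrite -product_measure1E; [|exact: measurable_itv|exact: measurable_box].
congr (_ _); apply/seteqP; split => [[t x] /= xI|[t x] [/= tI xI]].
  split => /=; first by have := xI ord0; rewrite tnth0.
  by move=> k; have := xI (lift ord0 k); rewrite tnthS.
move=> k; case: (unliftP ord0 k) => [j ->|->]; rewrite ?tnthS ?tnth0//.
Qed.

Lemma unit_cube_box d : @unit_cube R d = box (fun=> `[0, 1]).
Proof. by apply/seteqP; split=> x xI k; have := xI k; rewrite in_itv. Qed.

End box.

Section grid.
Context {R : realType}.

Definition grid_interval (N : nat) (j : nat) : interval R :=
  `[j%:R / N%:R, j.+1%:R / N%:R].

(** Neighbouring closed cubes share faces, which is harmless: only lower bounds on the mass and on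
    the hits of single cubes are used. *)
Definition grid_cube d (N : nat) (j : {ffun 'I_d -> 'I_N}) : set (d.-tuple R) :=
  box (fun k => grid_interval N (j k)).

Lemma grid_cube_sub d N (j : {ffun 'I_d -> 'I_N}) :
  grid_cube j `<=` @unit_cube R d.
Proof.
move=> x xj k; have := xj k; rewrite in_itv/= => /andP[jx xj1].
have N0 : (0 < N)%N by apply: leq_ltn_trans (ltn_ord (j k)).
apply/andP; split; first by apply: le_trans jx; rewrite divr_ge0.
by apply: (le_trans xj1); rewrite ler_pdivrMr ?ltr0n// mul1r ler_nat.
Qed.

Lemma lebesgue_grid_cube d N (j : {ffun 'I_d -> 'I_N}) :
  lebesgue_tuple d (grid_cube j) = ((N%:R ^- d)%:E : \bar R)%E.
Proof.
rewrite lebesgue_tuple_box; under eq_bigr => k _.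
  rewrite lebesgue_measure_itv/= lte_fin.
  rewrite ltr_pM2r ?invr_gt0 ?ltr0n ?(leq_ltn_trans _ (ltn_ord (j k)))//.
  rewrite ltr_nat ltnSn -EFinB -mulrBl -natr1 addrAC subrr add0r mul1r.
  over.
by rewrite prodEFin prodr_const card_ord exprVn.
Qed.

Lemma lebesgue_unit_cube d : lebesgue_tuple d (@unit_cube R d) = 1%E.
Proof.
rewrite unit_cube_box lebesgue_tuple_box big1// => k _.
by rewrite lebesgue_measure_itv/= lte_fin ltr01 oppr0 adde0.
Qed.

Context {dO : measure_display} {Omega : measurableType dO}.
Variable P : probability Omega R.

Lemma density_lower_bound d (X : Omega -> d.-tuple R) (f : d.-tuple R -> R)
    (b : R) (B : set (d.-tuple R)) :
  has_density_on_cube P X f -> 0 <= b -> (forall x, unit_cube x -> b <= f x) ->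
  measurable B -> B `<=` @unit_cube R d ->
  (b%:E * lebesgue_tuple d B <= P (X @^-1` B))%E.
Proof.
move=> [mf f0 PX] b0 bf mB Bcube; rewrite PX// setIidl// -integral_cst//.
apply: ge0_le_integral => //.
- apply/measurable_EFinP; apply: measurable_funS mf => //.
  by rewrite unit_cube_box; exact: measurable_box.
- by move=> x Bx; rewrite lee_fin; apply: bf; exact: Bcube.
Qed.

End grid.

Lemma grid_event {dO} {Omega : measurableType dO} {R : realType}
    (P : probability Omega R) (d n : nat)
    (X : 'I_n -> Omega -> d.-tuple R) (p : R) (m N : nat) :
  (forall i, measurable_fun setT (X i)) -> mutually_independent P X ->
  (forall i (j : {ffun 'I_d -> 'I_N}), (p%:E <= P (X i @^-1` grid_cube j))%E) ->
  4 * m%:R <= n%:R * p ->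
  exists E, [/\ measurable E,
    (P (~` E) <= (N%:R ^+ d * expR (- m%:R))%:E)%E &
    forall w, E w -> forall j : {ffun 'I_d -> 'I_N},
      (m <= \sum_(i < n) (X i w \in grid_cube (R := R) j))%N].
Proof.
move=> mX indepX pX pm.
have mB (j : {ffun 'I_d -> 'I_N}) : measurable (grid_cube (R := R) j).
  exact: measurable_box.
pose A (j : {ffun 'I_d -> 'I_N}) :=
  [set w | \sum_(i < n) \1_(grid_cube j) (X i w) < m%:R :> R].
have mA j : measurable (A j) by exact: (measurable_few_hits mX m (mB j)).
exists (~` \bigcup_(j in setT) A j); split.
- by apply: measurableC; apply: fin_bigcup_measurable.
- rewrite setCK (_ : N%:R ^+ d = #|{ffun 'I_d -> 'I_N}|%:R); last first.
    by rewrite card_ffun !card_ord natrX.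
  apply: measure_bigcup_finType_le => // j.
  exact: (prob_few_hits mX indepX (mB j) (pX ^~ j) pm).
- move=> w Ew j; rewrite leqNgt; apply/negP => lt_m; apply: Ew; exists j => //.
  by rewrite /A/=; under eq_bigr do rewrite indicE; rewrite -natr_sum ltr_nat.
Qed.

(** * Cells and partitions of the tree *)

Section cells.
Context {R : realType} {d : nat}.
Implicit Types (V W : hrect d (R := R)) (k : 'I_d) (x y : d.-tuple R) (b : bool).

(** The flags leave open which faces belong to the cell, since either child may own the cutting
    hyperplane. *)
Definition proper_cell V := forall k, exists b1 b2,
  [/\ tnth V k = Interval (BSide b1 (lower V k)) (BSide b2 (upper V k)),
      0 <= lower V k, lower V k < upper V k & upper V k <= 1].

Lemma proper_unit_hrect : proper_cell (unit_hrect d).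
Proof. by move=> k; exists true, false; rewrite /lower /upper tnth_mktuple/=. Qed.

Lemma lower_left_child b V s k : lower (left_child b V s) k = lower V k.
Proof. by rewrite /lower /left_child tnth_mktuple; case: eqP => [->|]. Qed.

Lemma upper_left_child b V s k :
  upper (left_child b V s) k = if k == s.1 then cut_point V s else upper V k.
Proof. by rewrite /upper /left_child tnth_mktuple; case: eqP. Qed.

Lemma lower_right_child b V s k :
  lower (right_child b V s) k = if k == s.1 then cut_point V s else lower V k.
Proof. by rewrite /lower /right_child tnth_mktuple; case: eqP. Qed.

Lemma upper_right_child b V s k : upper (right_child b V s) k = upper V k.
Proof. by rewrite /upper /right_child tnth_mktuple; case: eqP => [->|]. Qed.

Lemma cut_point_itv V s : proper_cell V -> admissible_splits s ->
  lower V s.1 < cut_point V s < upper V s.1.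
Proof.
move=> Vp /andP[u0 u1]; have [b1 [b2 [_ _ lu _]]] := Vp s.1.
rewrite /cut_point /side_length; apply/andP; split; nra.
Qed.

Lemma proper_left_child b V s : proper_cell V -> admissible_splits s ->
  proper_cell (left_child b V s).
Proof.
move=> Vp adm k; have /andP[lc cu] := cut_point_itv Vp adm.
have [b1 [b2 [Vk l0 lu u1]]] := Vp k.
rewrite lower_left_child upper_left_child /left_child tnth_mktuple.
have [ks|_] := eqVneq k s.1; last by exists b1, b2.
rewrite ks in Vk l0 lu u1 *; exists b1, b; split => //; first by rewrite Vk.
exact/ltW/(lt_le_trans cu).
Qed.

Lemma proper_right_child b V s : proper_cell V -> admissible_splits s ->
  proper_cell (right_child b V s).
Proof.
move=> Vp adm k; have /andP[lc cu] := cut_point_itv Vp adm.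
have [b1 [b2 [Vk l0 lu u1]]] := Vp k.
rewrite lower_right_child upper_right_child /right_child tnth_mktuple.
have [ks|_] := eqVneq k s.1; last by exists b1, b2.
rewrite ks in Vk l0 lu u1 *; exists b, b2; split => //; first by rewrite Vk.
exact: le_trans (ltW lc).
Qed.

Lemma le_BSide (a c : bool) (t u : R) : t < u -> (BSide a t <= BSide c u)%O.
Proof. by move=> tu; rewrite leBSide; exact: lteifS. Qed.

Lemma cut_bound_le b V s : proper_cell V -> admissible_splits s ->
  ((tnth V s.1).1 <= BSide b (cut_point V s) <= (tnth V s.1).2)%O.
Proof.
move=> Vp adm; have /andP[lc cu] := cut_point_itv Vp adm.
by have [b1 [b2 [-> _ _ _]]] := Vp s.1; rewrite /= !le_BSide.
Qed.

Lemma in_left_child b V s x : proper_cell V -> admissible_splits s ->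
  in_hrect (left_child b V s) x =
  in_hrect V x && (BRight (tnth x s.1) <= BSide b (cut_point V s))%O.
Proof.
move=> Vp adm; have := cut_bound_le b Vp adm => /andP[lc cu].
apply/forallP/andP => [xL|[/forallP xV xc] k].
  have := xL s.1; rewrite tnth_mktuple eqxx itv_boundlr => /andP[lx xc].
  split => //; apply/forallP => k; have := xL k; rewrite tnth_mktuple.
  case: eqP => [->|//] _; case: (tnth V s.1) lx cu => l r /= lx cu.
  by rewrite itv_boundlr lx (le_trans xc).
have := xV k; rewrite tnth_mktuple; case: eqP => [->|//].
by case: (tnth V s.1) => l r; rewrite !itv_boundlr/= xc => /andP[->].
Qed.

Lemma in_right_child b V s x : proper_cell V -> admissible_splits s ->
  in_hrect (right_child b V s) x =
  in_hrect V x && (BSide b (cut_point V s) <= BLeft (tnth x s.1))%O.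
Proof.
move=> Vp adm; have := cut_bound_le b Vp adm => /andP[lc cu].
apply/forallP/andP => [xL|[/forallP xV xc] k].
  have := xL s.1; rewrite tnth_mktuple eqxx itv_boundlr => /andP[xc xr].
  split => //; apply/forallP => k; have := xL k; rewrite tnth_mktuple.
  case: eqP => [->|//] _; case: (tnth V s.1) lc xr => l r /= lc xr.
  by rewrite itv_boundlr xr (le_trans lc).
have := xV k; rewrite tnth_mktuple; case: eqP => [->|//].
by case: (tnth V s.1) => l r; rewrite !itv_boundlr/= xc => /andP[_ ->].
Qed.

(** The membership conditions of the two children are complementary whichever child owns the
    hyperplane; covering and disjointness both rest on this. *)
Lemma cut_side b (t c : R) :
  (BSide b c <= BLeft t)%O = ~~ (BRight t <= BSide b c)%O.
Proof. by case: b; rewrite !bnd_simp/= -?leNgt -?ltNge. Qed.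

Lemma proper_cell_unit_cube V x : proper_cell V -> in_hrect V x -> unit_cube x.
Proof.
move=> Vp /forallP xV k; have := xV k.
have [b1 [b2 [-> l0 _ u1]]] := Vp k; rewrite itv_boundlr/= => /andP[lx xu].
by apply/andP; split; move: lx xu; case: b1; case: b2; rewrite !bnd_simp => lx xu; lra.
Qed.

Lemma side_length_le_h_plus V k : side_length V k <= h_plus V.
Proof. exact: le_bigmax. Qed.

Lemma h_minus_le_side_length V k : h_minus V <= side_length V k.
Proof. exact: bigmin_le. Qed.

Lemma dist_in_cell V x y : proper_cell V -> in_hrect V x -> in_hrect V y ->
  dist2 x y <= Num.sqrt d%:R * h_plus V.
Proof.
move=> Vp /forallP xV /forallP yV.
have hp0 : 0 <= h_plus V by exact: bigmax_ge_id.
have hpE : h_plus V = Num.sqrt (h_plus V ^+ 2) by rewrite sqrtr_sqr ger0_norm.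
rewrite [X in _ * X]hpE -sqrtrM ?ler0n//.
rewrite ler_sqrt; last by rewrite mulr_ge0// sqr_ge0.
apply: (@le_trans _ _ (\sum_(k < d) h_plus V ^+ 2)); last first.
  by rewrite sumr_const card_ord mulr_natl.
apply: ler_sum => k _; have := side_length_le_h_plus V k.
have := xV k; have := yV k; have [b1 [b2 [-> l0 _ u1]]] := Vp k.
rewrite !itv_boundlr/= /side_length.
case: b1; case: b2; rewrite !bnd_simp => /andP[ly yu] /andP[lx xu] su;
  rewrite -real_normK ?num_real// lerXn2r ?nnegrE ?normr_ge0// ler_norml; apply/andP; split; lra.
Qed.

End cells.

Section tree.
Context {R : realType} {d n : nat}.
Variables (beta : R) (m : nat) (side : bool).
Variable cost : ('I_n -> d.-tuple R * R) -> 'I_d * R -> hrect d (R := R) -> R.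
Variable z : 'I_n -> d.-tuple R * R.
Implicit Types (V W : hrect d (R := R)) (x : d.-tuple R) (Q : set (hrect d (R := R))).

(** The invariant of the construction: [S_beta] hands the shape condition to the children and [S_m]
    the count. *)
Definition good_cell V := [/\ proper_cell V, h_plus V <= beta * h_minus V &
  (m <= sample_count z V)%N].

Record good_partition Q : Prop := GoodPartition {
  good_partition_cell : forall V, Q V -> good_cell V;
  good_partition_cover : forall x, unit_cube x -> exists2 V, Q V & in_hrect V x;
  good_partition_disjoint : forall V W x,
    Q V -> Q W -> in_hrect V x -> in_hrect W x -> V = W }.

Lemma in_unit_hrect x : in_hrect (unit_hrect d) x <-> unit_cube x.
Proof.
split=> [/forallP xI k|xI]; first by have := xI k; rewrite tnth_mktuple in_itv.
by apply/forallP => k; rewrite tnth_mktuple in_itv; exact: xI.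
Qed.

Lemma good_partition_root : (0 < d)%N -> 1 <= beta ->
  (m <= sample_count z (unit_hrect d))%N -> good_partition [set unit_hrect d].
Proof.
move=> d0 beta1 mn; split.
- move=> V ->; split => //; first exact: proper_unit_hrect.
  have side1 k : side_length (unit_hrect d) k = 1 :> R.
    by rewrite /side_length /upper /lower tnth_mktuple /= subr0.
  have hp : h_plus (unit_hrect d (R := R)) = 1.
    apply/eqP; rewrite eq_le; apply/andP; split.
      by apply: bigmax_le => // k _; rewrite side1.
    by rewrite -(side1 (Ordinal d0)) side_length_le_h_plus.
  have hm : 1 <= h_minus (unit_hrect d (R := R)).
    by apply: le_bigmin => [|k _]; rewrite ?hp ?side1.
  by rewrite hp; nra.
- by move=> x x1; exists (unit_hrect d) => //; exact/in_unit_hrect.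
- by move=> V W x -> ->.
Qed.

Lemma sr_update_sub V Q W x : proper_cell V ->
  sr_update beta m side cost z V Q -> Q W -> in_hrect W x -> in_hrect V x.
Proof.
move=> Vp [[_ ->]|[_ [s [[[adm _] _] _] ->]]]; first by move=> ->.
by move=> [|] ->; rewrite ?in_left_child ?in_right_child// => /andP[].
Qed.

Lemma good_partition_step Q Q' : good_partition Q ->
  sr_step beta m side cost z Q Q' -> good_partition Q'.
Proof.
move=> [goodQ coverQ disjQ] [f fQ ->]; split.
- move=> W [V QV]; have [Vp _ _] := goodQ _ QV.
  case: (fQ _ QV) => [[_ ->] ->|]; first exact: goodQ.
  move=> [_ [s [[[adm hs] [_ ms]] _] ->]] Ws.
  have Ws' : W = left_child side V s \/ W = right_child side V s by [].
  split; [|exact: hs|exact: ms].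
  by case: Ws => ->; [exact: proper_left_child|exact: proper_right_child].
- move=> x x1; have [V QV xV] := coverQ _ x1; have [Vp _ _] := goodQ _ QV.
  case: (fQ _ QV) => [[_ fV]|[_ [s [[[adm _] _] _] fV]]].
    by exists V => //; exists V => //; rewrite fV.
  have [xs|xs] := boolP (BRight (tnth x s.1) <= BSide side (cut_point V s))%O.
    exists (left_child side V s); last by rewrite in_left_child// xV.
    by exists V => //; rewrite fV; left.
  exists (right_child side V s); last by rewrite in_right_child// xV cut_side.
  by exists V => //; rewrite fV; right.
- move=> V' W' x [V QV fV] [W QW fW] xV' xW'.
  have [Vp _ _] := goodQ _ QV; have [Wp _ _] := goodQ _ QW.
  (* A point in two new cells lies in both parents, which therefore coincide; the two children of
     one cell are then told apart by [cut_side]. *)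
  have VW : V = W.
    apply: (disjQ _ _ x) => //.
      exact: (sr_update_sub Vp (fQ _ QV) fV xV').
    exact: (sr_update_sub Wp (fQ _ QW) fW xW').
  rewrite -{}VW in QW Wp fW.
  case: (fQ _ QV) => [[_ fVE]|[_ [s [[[adm _] _] _] fVE]]].
    by move: fV fW; rewrite fVE => -> ->.
  move: fV fW xV' xW'; rewrite fVE.
  move=> [|] -> [|] -> //; rewrite in_left_child// in_right_child// cut_side;
    move=> /andP[_ xl] /andP[_ xr].
    by rewrite xl in xr.
  by rewrite xr in xl.
Qed.

Lemma good_partition_construction (Q : nat -> set (hrect d (R := R))) :
  (0 < d)%N -> 1 <= beta -> (m <= sample_count z (unit_hrect d))%N ->
  sr_construction beta m side cost z Q -> forall k, good_partition (Q k).
Proof.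
move=> d0 beta1 mn [Q0 Qstep]; elim => [|k IH].
  by rewrite Q0; exact: good_partition_root.
exact: good_partition_step IH (Qstep k).
Qed.

Lemma proper_cell_nonempty V : proper_cell V -> exists x, in_hrect V x.
Proof.
move=> Vp; exists [tuple (lower V k + upper V k) / 2 | k < d].
apply/forallP => k; rewrite tnth_mktuple.
have [b1 [b2 [-> _ lu _]]] := Vp k; rewrite itv_boundlr/= !le_BSide//; lra.
Qed.

(* A splittable cell of a stationary partition would be a child of a cell that
   it meets, hence of itself. *)
Lemma stationary_terminal Q : good_partition Q -> sr_step beta m side cost z Q Q ->
  forall V, Q V -> S_m m side z V = set0.
Proof.
move=> [goodQ _ disjQ] [f fQ QE] V QV.
have [Vp _ _] := goodQ _ QV.
case: (fQ _ QV) => [[]//|[_ [s [[[adm _] _] _] fV]]]; exfalso.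
have : (\bigcup_(W in Q) f W) V by rewrite -QE.
move=> [W QW fWV]; have [Wp _ _] := goodQ _ QW.
have [x xV] := proper_cell_nonempty Vp.
have WV : W = V := disjQ _ _ x QW QV (sr_update_sub Wp (fQ _ QW) fWV xV) xV.
have /andP[lc cu] := cut_point_itv Vp adm.
(* A child equal to [V] would have the cut as one of its own faces, but the cut lies strictly inside
   [V]. *)
move: fWV; rewrite WV fV => -[] VE.
  have := upper_left_child side V s s.1; rewrite -VE eqxx => uc.
  by rewrite uc ltxx in cu.
have := lower_right_child side V s s.1; rewrite -VE eqxx => uc.
by rewrite uc ltxx in lc.
Qed.

Lemma grid_cube_in_cell V (N : nat) : (0 < N)%N -> proper_cell V ->
  (forall k, 2 / N%:R < side_length V k) ->
  exists j : {ffun 'I_d -> 'I_N}, forall x, grid_cube j x -> in_hrect V x.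
Proof.
move=> N0 Vp bigV; have N0' : (0 : R) < N%:R by rewrite ltr0n.
have /choice[j jP] k : exists j : 'I_N,
    lower V k < j%:R / N%:R /\ j.+1%:R / N%:R < upper V k.
  have [b1 [b2 [_ l0 lu u1]]] := Vp k.
  have lN0 : 0 <= lower V k * N%:R by rewrite mulr_ge0// ltW.
  (* The grid interval of index t + 1 starts strictly above the lower end and, as the side exceeds
     2/N, stops strictly below the upper end. Strictness matters because the cell may be open at
     either end. *)
  have /andP[t1 t2] := truncn_itv lN0; set t := Num.truncn _ in t1 t2.
  have ut : t.+2%:R / N%:R < upper V k.
    rewrite ltr_pdivrMr// -natr1 -natr1.
    have := bigV k; rewrite /side_length ltr_pdivrMr//; lra.
  have tN : (t.+1 < N)%N.
    rewrite -(ltr_nat R); have := lt_le_trans ut u1.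
    rewrite ltr_pdivrMr// mul1r; apply: le_lt_trans; by rewrite ler_nat.
  by exists (Ordinal tN); split => //=; rewrite ltr_pdivlMr.
exists [ffun k => j k] => x xj; apply/forallP => k.
have [b1 [b2 [-> _ _ _]]] := Vp k.
have := xj k; rewrite ffunE in_itv/= => /andP[jx xj1].
have [lj ju] := jP k; rewrite itv_boundlr/=; apply/andP; split.
  by apply: le_BSide; exact: lt_le_trans jx.
by apply: le_BSide; exact: le_lt_trans xj1 _.
Qed.

Lemma sample_count_ge V (N : nat) : (0 < N)%N -> proper_cell V ->
  (forall j : {ffun 'I_d -> 'I_N}, (m <= \sum_(i < n) ((z i).1 \in grid_cube j))%N) ->
  (forall k, 2 / N%:R < side_length V k) -> (m <= sample_count z V)%N.
Proof.
move=> N0 Vp hit bigV; have [j jV] := grid_cube_in_cell N0 Vp bigV.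
apply: leq_trans (hit j) _; apply: leq_sum => i _.
by case: (boolP (_ \in grid_cube j)) => // /set_mem/jV ->.
Qed.

Lemma terminal_small V (N : nat) : (0 < d)%N -> (0 < N)%N -> proper_cell V ->
  (forall j : {ffun 'I_d -> 'I_N}, (m <= \sum_(i < n) ((z i).1 \in grid_cube j))%N) ->
  S_m m side z V = set0 -> h_minus V <= 4 / N%:R.
Proof.
move=> d0 N0 Vp hit term; rewrite leNgt; apply/negP => big.
have N0' : (0 : R) < N%:R by rewrite ltr0n.
have bigV k : 4 / N%:R < side_length V k.
  exact: lt_le_trans (h_minus_le_side_length V k).
(* [S_m] concerns counts alone, so the midpoint cut in the first direction serves: all sides of both
   halves still exceed 2/N. *)
pose s : 'I_d * R := (Ordinal d0, 2^-1).
have adm : admissible_splits s by rewrite /admissible_splits/=; apply/andP; split; lra.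
have : S_m m side z V s.
  split => // W WE; apply: (sample_count_ge N0) => //.
    by case: WE => ->; [exact: proper_left_child|exact: proper_right_child].
  have N2 : 4 / N%:R = 2 * (2 / N%:R) :> R by field; rewrite gt_eqF.
  have N3 : 0 < 2 / N%:R :> R by rewrite divr_gt0.
  move=> k; have := bigV k; have := bigV s.1.
  case: WE => ->; rewrite /side_length ?upper_left_child ?lower_left_child
    ?upper_right_child ?lower_right_child /cut_point /side_length; case: eqP => [->|_] /=; lra.
by rewrite term.
Qed.

End tree.

(** * Deterministic error bound for the tree estimator *)

Lemma between_hrect {R : realType} {d n : nat} (V : hrect d (R := R))
    (x : 'I_n -> d.-tuple R) : (exists i, in_hrect V (x i)) ->
  exists c, between x c = [set i | in_hrect V (x i)]%SET.
Proof.
move=> [i0 Vi0].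
(* In each direction, take the sample points of the cell with extreme coordinates. As the sides of
   [V] are intervals, every sample point between these extremes lies in [V]. *)
pose lo k := [arg min_(i < i0 | in_hrect V (x i)) tnth (x i) k]%O.
pose hi k := [arg max_(i > i0 | in_hrect V (x i)) tnth (x i) k]%O.
exists [ffun kb => if kb.2 then hi kb.1 else lo kb.1].
apply/finset.setP => i; rewrite !finset.inE.
apply/forallP/idP => [xi|Vi k]; last first.
  rewrite !ffunE/= /lo /hi.
  case: arg_minP => // j Vj jmin; case: arg_maxP => // j' Vj' jmax.
  by apply/andP; split; [exact: jmin|exact: jmax].
apply/forallP => k; have := xi k; rewrite !ffunE/= /lo /hi.
case: arg_minP => // j Vj _; case: arg_maxP => // j' Vj' _ jij'.
have : is_interval [set` tnth V k] by exact: interval_is_interval.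
move=> /(_ (tnth (x j) k) (tnth (x j') k)); apply => //=.
  by move/forallP : Vj; apply.
by move/forallP : Vj'; apply.
Qed.

Lemma deviation_bound_mean {R : realType} (sigma lam : R) (m k : nat) :
  0 <= lam -> (0 < m)%N -> (m <= k)%N ->
  deviation_bound sigma lam k / k%:R <=
  Num.sqrt (2 * sigma ^+ 2) * Num.sqrt (lam / m%:R).
Proof.
move=> lam0 m0 mk; have k0 : (0 : R) < k%:R by rewrite ltr0n (leq_trans m0).
have m0' : (0 : R) < m%:R by rewrite ltr0n.
have s0 : 0 <= 2 * sigma ^+ 2 by rewrite mulr_ge0// sqr_ge0.
rewrite /deviation_bound; move: (2 * sigma ^+ 2) s0 => v v0; rewrite -sqrtrM// ler_pdivrMr//.
have kE : k%:R = Num.sqrt (k%:R ^+ 2) :> R by rewrite sqrtr_sqr ger0_norm.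
rewrite [X in _ <= _ * X]kE -sqrtrM; last first.
  by rewrite mulr_ge0// divr_ge0// ltW.
rewrite ler_sqrt; last first.
  by rewrite mulr_ge0 ?sqr_ge0// mulr_ge0// divr_ge0// ltW.
rewrite -!mulrA ler_wpM2l// ler_wpM2l// expr2 mulrA ler_peMl ?(ltW k0)//.
by rewrite mulrC ler_pdivlMr// mul1r ler_nat.
Qed.

Section estimator.
Context {R : realType} {d n : nat}.
Variables (beta : R) (m N : nat) (side : bool).
Variable cost : ('I_n -> d.-tuple R * R) -> 'I_d * R -> hrect d (R := R) -> R.
Variable z : 'I_n -> d.-tuple R * R.
Variables (g : d.-tuple R -> R) (sigma lam L : R).
Hypotheses (d0 : (0 < d)%N) (m0 : (0 < m)%N) (N0 : (0 < N)%N).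
Hypotheses (beta1 : 1 <= beta) (lam0 : 0 <= lam).
Hypothesis hit : forall j : {ffun 'I_d -> 'I_N},
  (m <= \sum_(i < n) ((z i).1 \in grid_cube j))%N.
Hypothesis noise_le : forall c,
  `|\sum_(i in between (fun i => (z i).1) c) ((z i).2 - g (z i).1)| <=
  deviation_bound sigma lam #|between (fun i => (z i).1) c|.
Hypothesis lipg : lipschitz_on_cube L g.

(** Two opposite corners of the cube are at positive distance. *)
Lemma lipschitz_on_cube_ge0 : 0 <= L.
Proof.
have := lipg (_ : unit_cube [tuple 0 | _ < d]) (_ : unit_cube [tuple 1 | _ < d]).
have D0 : 0 < dist2 [tuple 0 | _ < d] [tuple 1 | _ < d] :> R.
  rewrite /dist2 sqrtr_gt0; under eq_bigr do rewrite !tnth_mktuple sub0r sqrrN expr1n.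
  by rewrite sumr_const card_ord ltr0n.
move=> /(_ _ _)H; rewrite -(pmulr_lge0 _ D0); apply: le_trans (H _ _) => //.
- by move=> k; rewrite tnth_mktuple lexx ler01.
- by move=> k; rewrite tnth_mktuple lexx ler01.
Qed.

Lemma tree_estimator_error (Q : nat -> set (hrect d (R := R))) (K : nat) x :
  sr_construction beta m side cost z Q -> Q K.+1 = Q K -> unit_cube x ->
  `|tree_estimator z (Q K) x - g x| <=
    Num.sqrt (2 * sigma ^+ 2) * Num.sqrt (lam / m%:R) +
    beta * L * Num.sqrt d%:R * (4 / N%:R).
Proof.
move=> constrQ QK x1.
(* Any single grid cube already brings [m] points into the unit cube. *)
have root : (m <= sample_count z (unit_hrect d))%N.
  apply: leq_trans (hit [ffun=> Ordinal N0]) _; apply: leq_sum => i _.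
  by case: (boolP (_ \in grid_cube _)) => // /set_mem/grid_cube_sub/in_unit_hrect ->.
have goodQ := good_partition_construction d0 beta1 root constrQ K.
have [V0 QV0 xV0] := good_partition_cover goodQ x1.
set V := local_map (Q K) x.
have [QV xV] : Q K V /\ in_hrect V x.
  by rewrite /V /local_map; case: xgetP => [? -> //|/(_ V0)]; case.
have [Vp hV mV] := good_partition_cell goodQ QV.
have term : S_m m side z V = set0.
  have stepK : sr_step beta m side cost z (Q K) (Q K).
    by case: constrQ => _ /(_ K); rewrite QK.
  exact: (stationary_terminal goodQ stepK QV).
have hm := terminal_small d0 N0 Vp hit term.
have L0 := lipschitz_on_cube_ge0.
pose J := [set i | in_hrect V (z i).1]%SET.
have JE : (sample_count z V = #|J|)%N.
  by rewrite /sample_count -sum1dep_card [RHS]big_mkcond; apply: eq_bigr => i _; case: in_hrect.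
have mJ : (m <= #|J|)%N by rewrite -JE.
have J0 : (0 : R) < #|J|%:R by rewrite ltr0n (leq_trans m0).
have [c cE] : exists c, between (fun i => (z i).1) c = J.
  apply: between_hrect; have /card_gt0P[i] : (0 < #|J|)%N by exact: leq_trans mJ.
  by rewrite finset.inE => Vi; exists i.
(* Mean noise over the cell plus bias. The first is bounded because [J] is one of the candidate
   sets, the second by the diameter of the cell. *)
have -> : tree_estimator z (Q K) x - g x =
    (\sum_(i in J) ((z i).2 - g (z i).1)) / #|J|%:R +
    (\sum_(i in J) (g (z i).1 - g x)) / #|J|%:R.
  rewrite /tree_estimator -/V -natr_sum -/(sample_count z V) JE -mulrDl.
  rewrite -big_split/= (_ : \sum_(i < n) _ = \sum_(i in J) (z i).2); last first.
    rewrite [RHS]big_mkcond; apply: eq_bigr => i _.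
    by rewrite finset.inE; case: in_hrect; rewrite ?mulr1 ?mulr0.
  under [in RHS]eq_bigr do rewrite addrA subrK.
  rewrite sumrB sumr_const mulrBl; congr (_ - _).
  by rewrite -(mulr_natr (g x)) mulfK// gt_eqF.
apply: (le_trans (ler_normD _ _)); apply: lerD.
  rewrite normrM (ger0_norm (x := _^-1)) ?invr_ge0 ?(ltW J0)//.
  apply: le_trans (deviation_bound_mean sigma lam0 m0 mJ).
  by rewrite ler_pM2r ?invr_gt0// -cE noise_le.
rewrite normrM (ger0_norm (x := _^-1)) ?invr_ge0 ?(ltW J0)// ler_pdivrMr//.
apply: le_trans (ler_norm_sum _ _ _) _.
rewrite mulr_natr -sumr_const; apply: ler_sum => i; rewrite finset.inE => Vi.
apply: le_trans (lipg _ _) _; [exact: proper_cell_unit_cube Vi|by []|].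
rewrite (_ : beta * L * _ * _ = L * (Num.sqrt d%:R * (beta * (4 / N%:R)))); last by ring.
rewrite ler_wpM2l//; apply: le_trans (dist_in_cell Vp Vi xV) _.
rewrite ler_wpM2l ?sqrtr_ge0//; apply: le_trans hV _.
by rewrite ler_wpM2l// (le_trans ler01).
Qed.

End estimator.

(** * From the law of the pair (X, Y) to the sample *)

Section transfer.
Context {dO dT} {Omega : measurableType dO} {T : measurableType dT} {R : realType}.
Variable P : probability Omega R.

Lemma integral_eq_law (Z Z' : Omega -> T) (f : T -> R) :
  measurable_fun setT Z -> measurable_fun setT Z' ->
  (forall B, measurable B -> P (Z @^-1` B) = P (Z' @^-1` B)) ->
  measurable_fun setT f -> (forall t, 0 <= f t) ->
  (\int[P]_w (f (Z w))%:E = \int[P]_w (f (Z' w))%:E)%E.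
Proof.
move=> mZ mZ' eqZ mf f0.
have pre (Y : Omega -> T) B : measurable_fun setT Y -> measurable B ->
    (\int[P]_w (1 * \1_B (Y w))%:E = P (Y @^-1` B))%E.
  move=> mY mB; have mYB : measurable (Y @^-1` B).
    by rewrite -[X in measurable X]setTI; exact: mY.
  under eq_integral do rewrite mul1r.
  by rewrite -[in RHS](setIT (Y @^-1` B)) -integral_indic.
have := @integral_weighted_comp _ _ _ _ _ P Z Z' (cst 1) (cst 1) mZ mZ'.
move=> /(_ _ _ _ _ f); under eq_integral do rewrite mul1r.
under [in X in _ = X]eq_integral do rewrite mul1r.
apply => // B mB.
by rewrite !pre//; exact: eqZ.
Qed.

Lemma mutually_independent_option (I : finType) (Z : option I -> Omega -> T) :
  mutually_independent P Z -> mutually_independent P (Z \o Some).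
Proof.
move=> indZ J B mB.
pose B' (j : option I) := if j is Some i then B i else setT.
have mB' j : measurable (B' j) by case: j => [i|]; [exact: mB|exact: measurableT].
have := indZ (Some @: J)%SET B' mB'.
rewrite big_imset/=; last by move=> i j _ _ [].
move=> <-; congr (P _); apply/seteqP; split => w H.
  move=> j /= /imsetP[i iJ ->] /=; exact: H.
by move=> i iJ; apply: (H (Some i)); apply/imsetP; exists i.
Qed.

End transfer.

Lemma mutually_independent_comp {dO dT dS} {Omega : measurableType dO}
    {T : measurableType dT} {S : measurableType dS} {R : realType}
    (P : probability Omega R) (I : finType) (Z : I -> Omega -> T) (f : T -> S) :
  measurable_fun setT f -> mutually_independent P Z ->
  mutually_independent P (fun i => f \o Z i).
Proof.
move=> mf indZ J B mB; apply: (indZ J (fun i => f @^-1` B i)) => i.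
by rewrite -[X in measurable X]setTI; exact: mf.
Qed.

Section conditional.
Context {dO dT} {Omega : measurableType dO} {T : measurableType dT} {R : realType}.
Variable P : probability Omega R.

Lemma cond_sub_gaussian_integral (X : Omega -> T) (eps : Omega -> R) (sigma s : R)
    (B : set T) :
  measurable_fun setT X -> measurable_fun setT eps ->
  cond_sub_gaussian P X eps sigma -> measurable B ->
  (\int[P]_w (expR (s * eps w) * \1_B (X w))%:E <=
   (expR (s ^+ 2 * sigma ^+ 2 / 2))%:E * P (X @^-1` B))%E.
Proof.
move=> mX meps [_ /(_ s)[h [_ mh hE] hle]] mB.
have mXB : measurable (X @^-1` B) by rewrite -[X in measurable X]setTI; exact: mX.
have -> : (\int[P]_w (expR (s * eps w) * \1_B (X w))%:E =
    \int[P]_(w in X @^-1` B) (expR (s * eps w))%:E)%E.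
  rewrite [RHS]integral_mkcond; apply: eq_integral => w _.
  rewrite patchE indicE (_ : (X w \in B) = (w \in X @^-1` B))//.
  by case: ifP => _; rewrite ?mulr1 ?mulr0.
rewrite hE// -integral_cst//.
have mhX : measurable_fun (X @^-1` B) (fun w => (h (X w))%:E).
  by apply/measurable_EFinP; apply: measurable_funTS; exact: measurableT_comp.
(* The version [h] is not known to be nonnegative everywhere, so it is replaced by its positive
   part, which obeys the same almost sure bound. *)
rewrite [X in (X <= _)%E]integralE; apply: (@le_trans _ _ (\int[P]_(w in X @^-1` B)
    ((fun w => (h (X w))%:E)^\+ w))%E).
  rewrite -[X in (_ <= X)%E]adde0. apply: leeD2l.
  by rewrite oppe_le0 integral_ge0.
apply: ae_ge0_le_integral => //.
- exact: measurable_funepos.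
- by move=> w _; rewrite lee_fin expR_ge0.
- case: hle => N [mN PN hN]; exists N; split => //.
  apply: subset_trans hN => w /= /not_implyP[_ nle] hw; apply: nle.
  by rewrite funeposE ge_max !lee_fin hw expR_ge0.
Qed.

End conditional.

(** * Rates *)

Section rate.
Context {R : realType}.

Lemma expR_log_term (d n : nat) (delta : R) : 0 < delta ->
  expR (- log_term d n delta) = delta / n.+1%:R ^+ (2 * d).
Proof.
move=> delta0; rewrite expRN /log_term lnK ?invf_div// posrE.
by rewrite divr_gt0// exprn_gt0.
Qed.

Lemma log_term_gt0 (d n : nat) (delta : R) : 0 < delta < 1 ->
  0 < log_term d n delta.
Proof.
move=> /andP[delta0 delta1]; apply: ln_gt0; rewrite ltr_pdivlMr// mul1r.
apply: (lt_le_trans delta1); rewrite exprn_ege1//.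
by rewrite ler1n.
Qed.

Lemma log_term_le_linear (d : nat) (delta c : R) : 0 < delta -> 0 < c ->
  exists n0 : nat, forall n, (n0 <= n)%N -> log_term d n delta <= c * n%:R.
Proof.
move=> delta0 c0; pose D := `|ln delta|; have D0 : 0 <= D by exact: normr_ge0.
(* With s = sqrt(n+1) and ln s <= s, the log term is at most 4 d s + D, to be compared with c (s^2 -
   1). The extra c in the numerator absorbs this -1 and makes S >= 1. *)
pose S := (4 * d%:R + D + c) / c.
have S1 : 1 <= S.
  by rewrite ler_pdivlMr// mul1r lerDr addr_ge0// mulr_ge0.
exists (Num.truncn (S ^+ 2)).+1 => n nn.
pose s := Num.sqrt n.+1%:R : R.
have s2 : s ^+ 2 = n%:R + 1 by rewrite sqr_sqrtr// natr1.
have s0 : 0 < s by rewrite sqrtr_gt0.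
have Ss : S <= s.
  rewrite -ler_sqr ?nnegrE ?(ltW s0) ?(le_trans ler01 S1)//.
  have := truncnS_gt (S ^+ 2); rewrite s2.
  have : (Num.truncn (S ^+ 2)).+1%:R <= n%:R :> R by rewrite ler_nat.
  lra.
have lns : ln s <= s.
  have := @le_ln1Dx R (s - 1); rewrite [1 + _]addrC subrK => H.
  by apply: le_trans (H _) _; lra.
have -> : log_term d n delta = 2 * (2 * d%:R) * ln s - ln delta.
  rewrite /log_term ln_div ?posrE ?exprn_gt0// lnXn// -[n.+1%:R]natr1 -s2 lnXn//.
  by rewrite -mulrnA -(mulr_natl (ln s)) !natrM.
have lnD : - ln delta <= D by rewrite /D -normrN ler_norm.
have SE : c * S = 4 * d%:R + D + c by rewrite /S mulrCA divff ?mulr1// gt_eqF.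
have dp : (0 : R) <= d%:R by exact: ler0n.
have key : (4 * d%:R + D + c) * s <= c * s ^+ 2.
  by rewrite -SE expr2 mulrA ler_pM2r// ler_pM2l.
rewrite s2 in key; have s1 : 1 <= s by exact: le_trans Ss.
nra.
Qed.

(* With a = n^(1/(d+2)) and l = lam^(1/(d+2)), the rate is t = l / a and the
   leaf size is r = a^2 l^d. *)
Lemma rate_identities (d n : nat) (lam : R) : (0 < n)%N -> 0 < lam ->
  let t := (n%:R^-1 * lam) `^ ((d + 2)%:R^-1) in
  let r := n%:R `^ (2 / (d + 2)%:R) * lam `^ (d%:R / (d + 2)%:R) in
  [/\ 0 < t, t ^+ (d + 2) = n%:R^-1 * lam, r = n%:R * t ^+ d & r * t ^+ 2 = lam].
Proof.
move=> n0 lam0; have n0' : (0 : R) < n%:R by rewrite ltr0n.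
have D0 : (d + 2)%:R != 0 :> R by rewrite pnatr_eq0 addn2.
pose a := n%:R `^ ((d + 2)%:R^-1) : R; pose l := lam `^ ((d + 2)%:R^-1).
have a0 : 0 < a by exact: powR_gt0.
have l0 : 0 < l by exact: powR_gt0.
have powE x k : 0 < x -> x `^ (k%:R / (d + 2)%:R) = (x `^ ((d + 2)%:R^-1)) ^+ k.
  by move=> x0; rewrite mulrC powRrM powR_mulrn// powR_ge0.
have aE : a ^+ (d + 2) = n%:R by rewrite -powE// divff// powRr1// ltW.
have lE : l ^+ (d + 2) = lam by rewrite -powE// divff// powRr1// ltW.
have tE : (n%:R^-1 * lam) `^ ((d + 2)%:R^-1) = l / a.
  have n_ge0 : (0 : R) <= n%:R by [].
  rewrite powRM ?invr_ge0 ?(ltW lam0)// -/l mulrC; congr (_ * _).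
  by rewrite -(powR_inv1 n_ge0) -powRrM mulrC powRrM powR_inv1 ?powR_ge0.
rewrite /= tE !powE//; split.
- by rewrite divr_gt0.
- by rewrite expr_div_n aE lE mulrC.
- rewrite -/a -/l -[in RHS]aE exprD expr_div_n; field.
  by rewrite expf_neq0// gt_eqF.
- rewrite -/a -/l -[RHS]lE exprD expr_div_n; field.
  by rewrite gt_eqF.
Qed.

(** N is the integer part of x = (n b / (4 m))^(1/d), where a grid cube of side 1/x has guaranteed
    mass 4m/n, or 1 if x < 1. Either way x <= 2 N, so 4/N <= 8/x, and [key] bounds 1/x. *)
Lemma grid_scale (A b t : R) (d n m : nat) :
  1 <= A -> 0 < b <= 1 -> 0 < t -> (0 < d)%N -> (0 < m)%N -> 4 * m%:R <= n%:R :> R ->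
  m%:R <= A * (n%:R * t ^+ d) ->
  exists N : nat, [/\ (0 < N)%N, N%:R ^+ d <= n%:R :> R,
    N = 1%N \/ 4 * m%:R <= n%:R * (b * N%:R ^- d) &
    4 / N%:R <= 8 * A * (5 / b) `^ (d%:R^-1) * t].
Proof.
move=> A1 /andP[b0 b1] t0 d0 m0 mn mt.
have A0 : 0 < A by exact: lt_le_trans A1.
have m0' : (0 : R) < m%:R by rewrite ltr0n.
have m1 : (1 : R) <= m%:R by rewrite ler1n.
have n0 : (0 : R) < n%:R by lra.
have rootK (y : R) : 0 < y -> (y `^ d%:R^-1) ^+ d = y.
  move=> y0; rewrite -powR_mulrn ?powR_ge0// -powRrM mulVf ?pnatr_eq0 -?lt0n//.
  by rewrite powRr1// ltW.
pose x := (n%:R * b / (4 * m%:R)) `^ d%:R^-1.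
have y0 : 0 < n%:R * b / (4 * m%:R) by rewrite divr_gt0 ?mulr_gt0.
have x0 : 0 < x by exact: powR_gt0.
have xE : x ^+ d = n%:R * b / (4 * m%:R) by exact: rootK.
pose v := (5 / b) `^ d%:R^-1.
have b5 : 0 < 5 / b by rewrite divr_gt0.
have v0 : 0 < v by exact: powR_gt0.
have vE : v ^+ d = 5 / b by exact: rootK.
(* The d-th power of the right side is 5 A^d n t^d / (4 m), at least 5/4 because m <= A n t^d and A
   <= A^d. *)
have key : 1 <= x * (A * v * t).
  rewrite -(ler_pXn2r d0) ?nnegrE ?ler01 ?(ltW (mulr_gt0 _ _)) ?mulr_gt0//.
  rewrite expr1n !exprMn xE vE.
  have -> : n%:R * b / (4 * m%:R) * (A ^+ d * (5 / b) * t ^+ d) =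
      5 * A ^+ d * (n%:R * t ^+ d) / (4 * m%:R).
    by field; rewrite !gt_eqF.
  rewrite ler_pdivlMr ?mulr_gt0// mul1r.
  have AA : A <= A ^+ d by rewrite -[leLHS]expr1 ler_weXn2l.
  have T0 : 0 < n%:R * t ^+ d by rewrite mulr_gt0// exprn_gt0.
  nra.
have done_if (N : nat) : (0 < N)%N -> x <= 2 * N%:R ->
    4 / N%:R <= 8 * A * v * t.
  move=> N0 xN; have N0' : (0 : R) < N%:R by rewrite ltr0n.
  rewrite ler_pdivrMr//.
  have w0 : 0 < A * v * t by rewrite !mulr_gt0.
  nra.
have [x1|x1] := leP 1 x; last first.
  exists 1%N; split => //; first by rewrite expr1n; lra.
    by left.
  by apply: done_if => //; lra.
have /andP[Nx xN] := truncn_itv (ltW x0); set N := Num.truncn x in Nx xN.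
have N0 : (0 < N)%N by rewrite /N truncn_gt0.
have N1 : (1 : R) <= N%:R by rewrite ler1n.
have Nd : N%:R ^+ d <= n%:R * b / (4 * m%:R).
  by rewrite -xE lerXn2r// nnegrE ?ler0n ?(ltW x0).
have Nd0 : 0 < N%:R ^+ d :> R by rewrite exprn_gt0// (lt_le_trans ltr01).
exists N; split => //.
- apply: (le_trans Nd); rewrite ler_pdivrMr ?mulr_gt0//; nra.
- right; rewrite mulrA ler_pdivlMr//.
  by move: Nd; rewrite ler_pdivlMr ?mulr_gt0// mulrC.
- by apply: done_if => //; rewrite -natr1 in xN; lra.
Qed.

End rate.

(** * Choice of constants and combination of the two events *)

Theorem corollary19 (R : realType) (A : R) (hA : 1 <= A) :
  exists C : R, 0 < C /\
  forall (delta : R) (d : nat), 0 < delta < 1 / 3 -> (1 <= d)%N ->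
  exists n0 : nat,
  forall (beta : R), 2 <= beta ->
  forall (dO : measure_display) (Omega : measurableType dO)
    (P : probability Omega R) (n : nat)
    (X : {RV P >-> d.-tuple R}) (Y : {RV P >-> R})
    (Xs : 'I_n -> {RV P >-> d.-tuple R}) (Ys : 'I_n -> {RV P >-> R})
    (fX g : d.-tuple R -> R) (M b sigma L : R),
  (* (a): the pair (X, Y) has index None, the sample has the indices Some i *)
  let XY := fun (j : option 'I_n) (w : Omega) =>
    if j is Some i then (Xs i w, Ys i w) else (X w, Y w) in
  mutually_independent P XY ->
  identically_distributed P XY ->
  (* (b) *)
  has_density_on_cube P X fX ->
  0 < M -> 0 < b ->
  (forall x, unit_cube x -> b <= fX x <= M) ->
  (* g(x) = E[Y | X = x] *)
  is_cond_expectation P X Y g ->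
  (* (c) *)
  cond_sub_gaussian P X (fun w => Y w - g (X w)) sigma ->
  (* (d) *)
  lipschitz_on_cube L g ->
  (n0 <= n)%N ->
  forall m : nat,
  let r := n%:R `^ (2 / (d + 2)%:R) *
           log_term d n delta `^ (d%:R / (d + 2)%:R) in
  A^-1 * r <= m%:R <= A * r ->
  (* the cost function, and the side to which cutting hyperplanes belong *)
  forall (cost : ('I_n -> d.-tuple R * R) -> 'I_d * R -> hrect d -> R)
    (side : bool),
  let c := Num.sqrt (2 * sigma ^+ 2) +
           beta * L * Num.sqrt d%:R * (5 / b) `^ (d%:R^-1) in
  let sample := fun (w : Omega) (i : 'I_n) => (Xs i w, Ys i w) in
  (* probability at least 1 - 3 delta, as an inner probability *)
  exists E : set Omega,
    [/\ measurable E, ((1 - 3 * delta)%:E <= P E)%E &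
    forall w, E w ->
    forall (Q : nat -> set (hrect d)) (K : nat),
    sr_construction beta m side cost (sample w) Q ->
    minimizers_exist beta m side cost (sample w) Q ->
    Q K.+1 = Q K ->
    (ereal_sup [set `|tree_estimator (sample w) (Q K) x - g x|%:E
                 | x in unit_cube (d := d)] <=
     (C * c * (n%:R^-1 * log_term d n delta) `^ ((d + 2)%:R^-1))%:E)%E].
Proof.
have A0 : 0 < A by exact: lt_le_trans hA.
(* The bias needs the factor 8 A of [grid_scale]; the noise needs only A. *)
exists (8 * A); split; first by rewrite mulr_gt0.
move=> delta d /andP[delta0 delta13] d0.
(* Requiring lam <= eta n makes t <= 1/(4 A), from which 4 m <= n and lam <= m follow. *)
have eta0 : 0 < ((4 * A)^-1) ^+ (d + 2) by rewrite exprn_gt0// invr_gt0 mulr_gt0.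
have [n1 lam_small] := log_term_le_linear d delta0 eta0.
exists n1.+1 => beta beta2 dO Omega P n X Y Xs Ys fX g M b sigma L XY indep iddist.
move=> dens M0 b0 bfM condg subg lipg n1n m r mr cost side c sample.
have n0 : (0 < n)%N by exact: leq_ltn_trans n1n.
have n0' : (0 : R) < n%:R by rewrite ltr0n.
have delta1 : 0 < delta < 1 by apply/andP; split; lra.
have lam0 := log_term_gt0 d n delta1.
have [] := rate_identities d n0 lam0.
have lam_le := lam_small n (ltnW n1n).
rewrite -/r; move: lam0 lam_le; set lam := log_term d n delta in r mr *.
set t := _ `^ _ => lam0 lam_le t0 tE rE rt.
have tA : t <= (4 * A)^-1.
  rewrite -(ler_pXn2r (n := d + 2)) ?addn2// ?nnegrE ?(ltW t0)//; last first.
    by rewrite invr_ge0 mulr_ge0// ltW.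
  by rewrite -addn2 tE mulrC ler_pdivrMr.
have tA4 : 4 * (A * t) <= 1.
  by move: tA; rewrite -[leRHS]mul1r ler_pdivlMr ?mulr_gt0// => tA; rewrite mulrA mulrC.
have tAt : t <= A * t by rewrite ler_peMl // ltW.
have t1 : t <= 1 by lra.
have /andP[rm mr'] := mr.
have r0 : 0 < r.
  rewrite rE mulr_gt0// exprn_gt0//.
have rAm : r <= A * m%:R by move: rm; rewrite mulrC ler_pdivrMr// mulrC.
have m0' : (0 : R) < m%:R by rewrite -(pmulr_rgt0 _ A0) (lt_le_trans r0).
have m0 : (0 < m)%N by rewrite -(ltr0n R).
have td : t ^+ d <= t by rewrite -[leRHS]expr1 ler_wiXn2l// ltW.
have m4n : 4 * m%:R <= n%:R :> R.
  apply: (@le_trans _ _ (n%:R * (4 * (A * t)))); last by rewrite ler_piMr// ltW.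
  apply: (@le_trans _ _ (4 * (A * r))); first by rewrite ler_pM2l.
  rewrite rE (_ : 4 * _ = n%:R * (4 * (A * t ^+ d))); last by ring.
  by rewrite ler_pM2l// ler_pM2l// ler_pM2l.
have At0 : 0 < A * t by rewrite mulr_gt0.
have lam_At : lam <= m%:R * (A * t * t).
  rewrite -rt (_ : m%:R * _ = A * m%:R * t ^+ 2); last by ring.
  by rewrite ler_wpM2r// sqr_ge0.
have lam_m : lam <= m%:R.
  apply: le_trans lam_At _; rewrite ler_piMr// ?(ltW m0')//; nra.
(* From lam = r t^2 and r <= A m one gets lam / m <= A t^2, at most (A t)^2 since A >= 1. *)
have sqrt_lam : Num.sqrt (lam / m%:R) <= A * t.
  rewrite -[leRHS]ger0_norm ?(ltW At0)// -sqrtr_sqr ler_sqrt ?sqr_ge0//.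
  by rewrite ler_pdivrMr// mulrC; nra.
have L0 := lipschitz_on_cube_ge0 d0 lipg.
have mcube : measurable (@unit_cube R d) by rewrite unit_cube_box; exact: measurable_box.
have bf x : unit_cube x -> b <= fX x by move=> /bfM/andP[].
have mX (B : set (d.-tuple R)) : measurable B -> measurable (X @^-1` B).
  by move=> mB; rewrite -[X in measurable X]setTI; exact: measurable_funPT.
have Xcube1 : P (X @^-1` @unit_cube R d) = 1%E.
  have Xcube0 : P (X @^-1` (~` @unit_cube R d)) = 0%E.
    case: dens => _ _ ->; last exact: measurableC.
    by rewrite setICl integral_set0.
  have := probability_setC P (mX _ (measurableC mcube)).
  by rewrite Xcube0 sube0 preimage_setC setCK.
(* The density integrates to 1 over a cube of volume 1. *)
have b1 : 0 < b <= 1.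
  rewrite b0 -lee_fin -[leRHS]Xcube1 -[leLHS]mule1 -(lebesgue_unit_cube d).
  exact: (density_lower_bound dens (ltW b0) bf).
have rA : m%:R <= A * (n%:R * t ^+ d) by rewrite -rE.
have [N [N0 Nn Ncase Nle]] := grid_scale hA b1 t0 d0 m0 m4n rA.
(* For N = 1 the only grid cube is the whole cube, whose mass 1 may be much larger than b. *)
pose p := if N == 1%N then 1 else b * N%:R ^- d.
have pm : 4 * m%:R <= n%:R * p.
  rewrite /p; case: Ncase => [->|]; first by rewrite eqxx mulr1.
  by case: eqP => // _ _; rewrite mulr1.
pose Z (i : 'I_n) (w : Omega) := (Xs i w, Ys i w).
pose Z0 (w : Omega) := (X w, Y w).
have mZ i : measurable_fun setT (Z i) by apply: measurable_fun_pair.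
have mZ0 : measurable_fun setT Z0 by apply: measurable_fun_pair.
have indepZ : mutually_independent P Z := mutually_independent_option indep.
have lawZ i B : measurable B -> P (Z i @^-1` B) = P (Z0 @^-1` B).
  exact: (iddist (Some i) None).
have mg : measurable_fun setT g by case: condg.
pose noise (z : d.-tuple R * R) := z.2 - g z.1.
have mnoise : measurable_fun setT noise.
  by apply: measurable_funB => //; exact: measurableT_comp.
have subZ i s (B : set (d.-tuple R)) : measurable B ->
    (\int[P]_w (expR (s * noise (Z i w)) * \1_B (Z i w).1)%:E <=
     (expR (s ^+ 2 * sigma ^+ 2 / 2))%:E * P (Z i @^-1` (fst @^-1` B)))%E.
  move=> mB.
  have mf : measurable_fun setT (fun z => expR (s * noise z) * \1_B z.1).
    apply: measurable_funM.
      by apply: (measurableT_comp (@measurable_expR R)); exact: measurable_funM.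
    by apply: measurableT_comp => //; exact: measurable_indic.
  rewrite (integral_eq_law (mZ i) mZ0 (lawZ i) mf); last first.
    by move=> z; rewrite mulr_ge0 ?expR_ge0.
  rewrite (lawZ i); last first.
    by rewrite -[X in measurable X]setTI; exact: measurable_fst.
  apply: cond_sub_gaussian_integral => //.
  exact: measurableT_comp mnoise mZ0.
have [E1 [mE1 PE1 noise1]] := noise_event mZ indepZ mnoise subZ (ltW lam0).
have mXs i : measurable_fun setT (Xs i) by [].
have indepX : mutually_independent P (fun i => Xs i : Omega -> d.-tuple R).
  exact: (mutually_independent_comp (@measurable_fst _ _ _ _) indepZ).
have pX i (j : {ffun 'I_d -> 'I_N}) : (p%:E <= P (Xs i @^-1` grid_cube j))%E.
  have mB : measurable (grid_cube (R := R) j) by exact: measurable_box.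
  have -> : P (Xs i @^-1` grid_cube j) = P (X @^-1` grid_cube j).
    apply: (lawZ i (fst @^-1` grid_cube j)).
    by rewrite -[X in measurable X]setTI; exact: measurable_fst.
  rewrite /p; case: eqP => [N1|_].
    rewrite -Xcube1; apply: le_measure; rewrite ?inE; [exact: mX|exact: mX|].
    move=> w Xw k; have := Xw k; rewrite in_itv/=.
    have -> : (j k : nat) = 0%N.
      by move: (ltn_ord (j k)); rewrite [X in (_ < X)%N -> _]N1; case: (nat_of_ord (j k)).
    by rewrite N1 mul0r divr1.
  rewrite EFinM -(lebesgue_grid_cube j).
  exact: (density_lower_bound dens (ltW b0) bf mB (@grid_cube_sub _ _ _ j)).
have [E2 [mE2 PE2 hit]] := grid_event mXs indepX pX pm.
have expE : expR (- lam) = delta / n.+1%:R ^+ (2 * d) by exact: expR_log_term.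
have pow0 : 0 < n.+1%:R ^+ (2 * d) :> R by rewrite exprn_gt0.
have PC1 : (P (~` E1) <= (2 * delta)%:E)%E.
  apply: (le_trans PE1); rewrite lee_fin expE -mulrA ler_pM2l// mulrCA.
  by rewrite ler_piMr ?(ltW delta0)// ler_pdivrMr// mul1r lerXn2r ?nnegrE// ler_nat.
(* N^d <= n and lam <= m give N^d exp(-m) <= n exp(-lam) = n delta / (n+1)^(2d). The two signs of
   the noise account for the other 2 delta. *)
have PC2 : (P (~` E2) <= delta%:E)%E.
  apply: (le_trans PE2); rewrite lee_fin.
  apply: (@le_trans _ _ (n%:R * expR (- lam))).
    by rewrite ler_pM ?expR_ge0 ?exprn_ge0// ler_expR lerN2.
  rewrite expE mulrCA ler_piMr ?(ltW delta0)// ler_pdivrMr// mul1r.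
  apply: (@le_trans _ _ (n.+1%:R ^+ 1)); first by rewrite expr1 ler_nat.
  by rewrite ler_weXn2l ?ler1n// muln_gt0.
have mE : measurable (E1 `&` E2) by exact: measurableI.
exists (E1 `&` E2); split => //.
- have PC : (P (~` (E1 `&` E2)) <= (3 * delta)%:E)%E.
    rewrite setCI; apply: le_trans (measureU2 _ _ _) _; [exact: measurableC|exact: measurableC|].
    rewrite (_ : 3 * delta = 2 * delta + delta); last by ring.
    by rewrite EFinD leeD.
  have PCE := probability_setC P mE; rewrite PCE in PC.
  have PE : P (E1 `&` E2) \is a fin_num by exact: fin_num_measure.
  by move: PC; rewrite -(fineK PE) -EFinB !lee_fin; lra.
- move=> w [E1w E2w] Q K constrQ minQ QK.
  apply: ub_ereal_sup => _ [x x1 <-]; rewrite lee_fin.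
  have beta1 : 1 <= beta by lra.
  have err := @tree_estimator_error R d n beta m N side cost (sample w) g sigma
    lam L d0 m0 N0 beta1 (ltW lam0) (hit w E2w) (noise1 w E1w) lipg Q K x
    constrQ QK x1.
  apply: le_trans err _.
  have B0 : 0 <= beta * L * Num.sqrt d%:R.
    by rewrite !mulr_ge0 ?sqrtr_ge0//; lra.
  have s0 : 0 <= Num.sqrt (2 * sigma ^+ 2) by exact: sqrtr_ge0.
  rewrite /c -/lam -/t mulrDr mulrDl; apply: lerD.
    apply: le_trans (ler_wpM2l s0 sqrt_lam) _.
    by have := mulr_ge0 s0 (ltW At0); lra.
  apply: le_trans (ler_wpM2l B0 Nle) _.
  by rewrite le_eqVlt; apply/orP; left; apply/eqP; ring.
Qed.
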